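(* Consider the two-dimensional PCP finite volume HWENO scheme for the special relativistic hydrodynamics equations with the Lax--Friedrichs fluxes, whose spatial operator for the cell averages is $$\mathcal L_U(\mathbf U_h,i,j)=-\sum_{\ell=1}^3\omega_\ell\frac{\hat{\mathbf F}^1_{i+\frac12,j+b_\ell}-\hat{\mathbf F}^1_{i-\frac12,j+b_\ell}}{\Delta x}-\sum_{\ell=1}^3\omega_\ell\frac{\hat{\mathbf F}^2_{i+b_\ell,j+\frac12}-\hat{\mathbf F}^2_{i+b_\ell,j-\frac12}}{\Delta y},$$ $$\hat{\mathbf F}^1_{i+\frac12,j+b_\ell}=\tfrac12\Big(\mathbf F_1(\mathbf U_{i\oplus\frac12,j\oplus b_\ell})+\mathbf F_1(\mathbf U_{(i+1)\oplus(-\frac12),j\oplus b_\ell})-\alpha_1\big(\mathbf U_{(i+1)\oplus(-\frac12),j\oplus b_\ell}-\mathbf U_{i\oplus\frac12,j\oplus b_\ell}\big)\Big),$$ $$\hat{\mathbf F}^2_{i+b_\ell,j+\frac12}=\tfrac12\Big(\mathbf F_2(\mathbf U_{i\oplus b_\ell,j\oplus\frac12})+\mathbf F_2(\mathbf U_{i\oplus b_\ell,(j+1)\oplus(-\frac12)})-\alpha_2\big(\mathbf U_{i\oplus b_\ell,(j+1)\oplus(-\frac12)}-\mathbf U_{i\oplus b_\ell,j\oplus\frac12}\big)\Big),$$ where $\mathbf U_{i\oplus a,j\oplus b}$ are the PCP-limited HWENO point values described in the context, and $\alpha_1=\max_{i,j,\ell}\max\{\varrho_1(\mathbf U_{i\oplus\frac12,j\oplus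 b_\ell}),\varrho_1(\mathbf U_{(i+1)\oplus(-\frac12),j\oplus b_\ell})\}$, $\alpha_2=\max_{i,j,\ell}\max\{\varrho_2(\mathbf U_{i\oplus b_\ell,j\oplus\frac12}),\varrho_2(\mathbf U_{i\oplus b_\ell,(j+1)\oplus(-\frac12)})\}$. If $\overline{\mathbf U}_{i,j}\in\mathcal G$ for all $i,j$, then $$\overline{\mathbf U}_{i,j}+\Delta t\,\mathcal L_U(\mathbf U_h,i,j)\in\mathcal G\qquad\text{for all } i,j$$ under the CFL condition $$\Delta t\le\frac{\hat\omega_1}{\alpha_1/\Delta x+\alpha_2/\Delta y},\qquad \hat\omega_1=\tfrac1{12}.$$
   Context: **Equations.** $\gamma\in(1,2]$. $\mathbf U=(D,m_1,m_2,E)^\top$, $\mathbf F_1=(Dv_1,m_1v_1+p,m_2v_1,m_1)^\top$, $\mathbf F_2=(Dv_2,m_1v_2,m_2v_2+p,m_2)^\top$. $\mathcal G=\{\mathbf U\in\mathbb R^4: D>0,\ g(\mathbf U):=E-\sqrt{D^2+m_1^2+m_2^2}>0\}$. For $\mathbf U\in\mathcal G$, $(\rho,\mathbf v,p)$ is the unique triple with $\rho>0$, $p>0$, $|\mathbf v|<1$ and $D=\rho W$, $\mathbf m=DhW\mathbf v$, $E=DhW-p$, where $W=1/\sqrt{1-|\mathbf v|^2}$, $h=1+e+p/\rho$, $e=\frac p{(\gamma-1)\rho}$; thus $\mathbf F_1,\mathbf F_2$ are functions of $\mathbf U\in\mathcal G$. $\varrho_k(\mathbf U)$ is the spectral radius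 of $\partial\mathbf F_k/\partial\mathbf U$, $k=1,2$. Time step $\Delta t>0$. **Mesh and data.** Uniform cells $I_{i,j}=[x_{i-1/2},x_{i+1/2}]\times[y_{j-1/2},y_{j+1/2}]$ with center $(x_i,y_j)$ and sizes $\Delta x,\Delta y$, finitely many (neighbouring values needed at the boundary come from ghost cells supplied by the boundary conditions, treated like all other cells). $\mathbf U_h$ consists of the moments $\overline{\mathbf U}_{i,j}\approx\frac1{\Delta x\Delta y}\int_{I_{i,j}}\mathbf U$, $\overline{\mathbf V}_{i,j}\approx\frac1{\Delta x\Delta y}\int_{I_{i,j}}\mathbf U\frac{x-x_i}{\Delta x}$, $\overline{\mathbf W}_{i,j}\approx\frac1{\Delta x\Delta y}\int_{I_{i,j}}\mathbf U\frac{y-y_j}{\Delta y}$. Three-point Gauss weights $\omega_1=\omega_3=\frac5{18}$, $\omega_2=\frac49$ and nodes $b_1=-\frac{\sqrt{15}}{10}$, $b_2=0$, $b_3=\frac{\sqrt{15}}{10}$. $\mathbf U_{i\oplus a,j\oplus b}$ denotes the approximation at $(x_i+a\Delta x,y_j+b\Delta y)$ computed within $I_{i,j}$. The $3\times3$ block of cells around $I_{i,j}$ is numbered row by row from the bottom left: $I^1_{i,j}=I_{i-1,j-1}$, $I^2_{i,j}=I_{i,j-1}$, $I^3_{i,j}=I_{i+1,j-1}$, $I^4_{i,j}=I_{i-1,j}$, $I^5_{i,j}=I_{i,j}$, $I^6_{i,j}=I_{i+1,j}$, $I^7_{i,j}=I_{i-1,j+1}$, $I^8_{i,j}=I_{i,j+1}$,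 $I^9_{i,j}=I_{i+1,j+1}$. $\mathbf U^S_{i,j}$ is the matrix of the nine averages over $I^1_{i,j},\dots,I^9_{i,j}$; $\mathbf V^S_{i,j},\mathbf W^S_{i,j}$ are the matrices of the first moments in cells numbered $2,4,5,6,8$. **Scalar reconstruction operators.** Given numbers $u_1,\dots,u_9$ and $v_k,w_k$ ($k=2,4,5,6,8$): $P_0(x,y)$ is the polynomial of total degree $\le4$ whose averages over $I^k_{i,j}$ equal $u_k$ ($k=1,\dots,9$), whose scaled first $x$- and $y$-moments on $I^5_{i,j}$ equal $v_5,w_5$, and which, subject to these constraints, minimizes the sum over $k=2,4,6,8$ of the squared differences between its scaled first $x$- and $y$-moments on $I^k_{i,j}$ and $v_k,w_k$ (scaled first moments on a cell are normalized by the cell area and use the coordinates relative to that cell's center divided by $\Delta x$, resp. $\Delta y$). $P_1,P_2,P_3,P_4$ are the polynomials of total degree $\le2$ with averages $u_k$ on $I^k_{i,j}$ for $k\in\{1,2,4,5\}$, $\{2,3,5,6\}$, $\{4,5,7,8\}$, $\{5,6,8,9\}$ respectively, and first moments $v_5,w_5$ on $I^5_{i,j}$. $M_L(\cdot,\cdot,\cdot,\xi,\eta)=P_0(x_i+\xi\Delta x,y_j+\eta\Delta y)$ and $M_H(\cdot,\cdot,\cdot,\xi,\eta)=P_H(x_i+\xi\Delta x,y_j+\eta\Delta y)$ with $P_H=\omega_0^{H}\big(\frac1{\gamma_0}P_0-\sum_{n=1}^4\frac{\gamma_n}{\gamma_0}P_n\big)+\sum_{n=1}^4\omega_n^{H}P_n$,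 where $\gamma_n>0$ are linear weights with sum $1$, $\omega_n^{H}=\bar\omega_n/\sum_{k=0}^4\bar\omega_k$, $\bar\omega_n=\gamma_n\big(1+\frac{\tau^2}{\beta_n^2+\epsilon}\big)$, $\tau=\frac14\sum_{n=0}^4|\beta_0-\beta_n|$, $\epsilon>0$ small, $\beta_n=\sum_{|l|=1}^r|I_{i,j}|^{|l|-1}\int_{I_{i,j}}\big(\frac{\partial^{|l|}P_n}{\partial x^{l_1}\partial y^{l_2}}\big)^2dxdy$, $r$ the degree of $P_n$. $\mathbf M_L,\mathbf M_H$ apply these componentwise (row by row). **Reconstruction.** Some cells are marked as troubled by a troubled-cell indicator (KXRCF), and first moments in those cells are first modified by an HWENO limiter; no property of the indicator or of the modification is needed. For all $\ell,k\in\{1,2,3\}$: $\mathbf U^*_{i\oplus b_\ell,j\oplus b_k}=\mathbf M_L(\mathbf U^S_{i,j},\mathbf V^S_{i,j},\mathbf W^S_{i,j},b_\ell,b_k)$. At interface points $(\xi,\eta)=(\pm\frac12,b_\ell)$ or $(b_\ell,\pm\frac12)$: if $I_{i,j}$ is not troubled, $\mathbf U^*_{i\oplus\xi,j\oplus\eta}=\mathbf M_L(\mathbf U^S_{i,j},\mathbf V^S_{i,j},\mathbf W^S_{i,j},\xi,\eta)$; if it is troubled, $\mathbf U^*_{i\oplus\xi,j\oplus\eta}=\mathbf R\,\mathbf M_H(\mathbf R^{-1}\mathbf U^S_{i,j},\mathbf R^{-1}\mathbf V^S_{i,j},\mathbf R^{-1}\mathbf W^S_{i,j},\xi,\eta)$,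 where $\mathbf R$ is the invertible right-eigenvector matrix of a Roe matrix (for $\mathbf F_1$ at the interface $(i\pm\frac12,j)$, for $\mathbf F_2$ at $(i,j\pm\frac12)$). **PCP limiter.** Let $\Theta=\{(b_\ell,b_k)\}\cup\{(\pm\frac12,b_\ell)\}\cup\{(b_\ell,\pm\frac12)\}$, $\mathbf U^*_{i\oplus a,j\oplus b}=(D^*,m_1^*,m_2^*,E^* )^\top_{i\oplus a,j\oplus b}$ for $(a,b)\in\Theta$, $\overline D_{i,j}$ the first component of $\overline{\mathbf U}_{i,j}$, $\lambda_1=\Delta t/\Delta x$, $\lambda_2=\Delta t/\Delta y$, $\mu_1=\frac{\lambda_1\alpha_1}{\lambda_1\alpha_1+\lambda_2\alpha_2}$, $\mu_2=\frac{\lambda_2\alpha_2}{\lambda_1\alpha_1+\lambda_2\alpha_2}$ (with $\alpha_1,\alpha_2$ as in the claim; all these relations are understood to hold simultaneously). For a family $Z$ of values at interface points put $$\Pi(\overline Z;Z)=\frac{\overline Z_{i,j}-\sum_{\ell=1}^3\omega_\ell\hat\omega_1\big[\mu_1(Z_{i\oplus\frac12,j\oplus b_\ell}+Z_{i\oplus(-\frac12),j\oplus b_\ell})+\mu_2(Z_{i\oplus b_\ell,j\oplus\frac12}+Z_{i\oplus b_\ell,j\oplus(-\frac12)})\big]}{1-2\hat\omega_1}.$$ Step 1: $\widetilde D_{i\oplus a,j\oplus b}=\theta_D(D^*_{i\oplus a,j\oplus b}-\overline D_{i,j})+\overline D_{i,j}$, $\theta_D=\min\{|\frac{\overline D_{i,j}-\epsilon_D}{\overline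 D_{i,j}-D_{\min}}|,1\}$, $D_{\min}=\min\{\min_{(a,b)\in\Theta}D^*_{i\oplus a,j\oplus b},\ \Pi(\overline D;D^* )\}$, $\epsilon_D=\min_{i,j}\{10^{-13},\overline D_{i,j}\}$. Step 2: with $\widetilde{\mathbf U}_{i\oplus a,j\oplus b}=(\widetilde D,m_1^*,m_2^*,E^* )^\top_{i\oplus a,j\oplus b}$, $\mathbf U_{i\oplus a,j\oplus b}=\theta_g(\widetilde{\mathbf U}_{i\oplus a,j\oplus b}-\overline{\mathbf U}_{i,j})+\overline{\mathbf U}_{i,j}$, $\theta_g=\min\{|\frac{g(\overline{\mathbf U}_{i,j})-\epsilon_g}{g(\overline{\mathbf U}_{i,j})-g_{\min}}|,1\}$, $g_{\min}=\min\{\min_{(a,b)\in\Theta}g(\widetilde{\mathbf U}_{i\oplus a,j\oplus b}),\ g(\Pi(\overline{\mathbf U};\widetilde{\mathbf U}))\}$, $\epsilon_g=\min_{i,j}\{10^{-13},g(\overline{\mathbf U}_{i,j})\}$. ($\theta=1$ when the denominator vanishes.) *)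

(* Defs.v *)
From mathcomp Require Import all_boot all_order all_algebra.
From mathcomp Require Import all_classical all_reals all_analysis.
From mathcomp Require Import complex.
From mathcomp.multinomials Require mpoly.
Import -(notations) mpoly.
Set Implicit Arguments.
Unset Strict Implicit.
Unset Printing Implicit Defensive.
Import Order.TTheory GRing.Theory Num.Theory.
Import numFieldNormedType.Exports.
Local Open Scope classical_set_scope.
Local Open Scope ring_scope.

Notation state R := 'rV[R]_4.

Definition cD : 'I_4 := @Ordinal 4 0 isT.
Definition cm1 : 'I_4 := @Ordinal 4 1 isT.
Definition cm2 : 'I_4 := @Ordinal 4 2 isT.
Definition cE : 'I_4 := @Ordinal 4 3 isT.

Section Equations.
Variable R : realType.
Implicit Types (U : state R) (A : 'M[R]_4).

Definition mkstate (D m1 m2 E : R) : state R :=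
  \row_(c < 4) nth 0 [:: D; m1; m2; E] c.

Definition g U : R :=
  U 0 cE - Num.sqrt (U 0 cD ^+ 2 + U 0 cm1 ^+ 2 + U 0 cm2 ^+ 2).

Definition G : set (state R) := [set U : state R | 0 < U 0 cD /\ 0 < g U].

Variable gamma : R.

(* [w = (rho, v1, v2, p)] *)
Definition is_primitive U (w : R * R * R * R) : Prop :=
  let: (rho, v1, v2, p) := w in
  let W := 1 / Num.sqrt (1 - (v1 ^+ 2 + v2 ^+ 2)) in
  let e := p / ((gamma - 1) * rho) in
  let h := 1 + e + p / rho in
  [/\ 0 < rho, 0 < p, Num.sqrt (v1 ^+ 2 + v2 ^+ 2) < 1 &
   [/\ U 0 cD = rho * W,
       U 0 cm1 = U 0 cD * h * W * v1,
       U 0 cm2 = U 0 cD * h * W * v2 &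
       U 0 cE = U 0 cD * h * W - p]].

(* Total, but meaningful only on the open set [G], where the primitive
   variables exist and are unique. *)
Definition primitive U : R * R * R * R :=
  xget (0, 0, 0, 0) [set w | is_primitive U w].

Definition flux1 U : state R :=
  let: (_, v1, _, p) := primitive U in
  mkstate (U 0 cD * v1) (U 0 cm1 * v1 + p) (U 0 cm2 * v1) (U 0 cm1).

Definition flux2 U : state R :=
  let: (_, _, v2, p) := primitive U in
  mkstate (U 0 cD * v2) (U 0 cm1 * v2) (U 0 cm2 * v2 + p) (U 0 cm2).

(* The library's [jacobian] acts on row vectors, hence the transposition. *)
Definition flux_jacobian (F : state R -> state R) U : 'M[R]_4 :=
  (jacobian F U)^T.

Definition spectral_radius A : R :=
  sup [set Normc.normc z | z in
        [set z | eigenvalue (map_mx (real_complex R) A) z]].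

Definition varrho1 U : R := spectral_radius (flux_jacobian flux1 U).
Definition varrho2 U : R := spectral_radius (flux_jacobian flux2 U).

(* Roe's conditions: real diagonalizability (hyperbolicity), the
   Rankine-Hugoniot property, and consistency with the Jacobian. *)
Definition roe_matrix (F : state R -> state R) Ul Ur A : Prop :=
  [/\ diagonalizable A,
      A *m (Ur - Ul)^T = (F Ur - F Ul)^T &
      Ul = Ur -> A = flux_jacobian F Ul].

Definition right_eigenvector_matrix A (P : 'M[R]_4) : Prop :=
  P \in unitmx /\ exists L : 'rV[R]_4, A *m P = P *m diag_mx L.

Definition lax_friedrichs (F : state R -> state R) (alpha : R) Um Up :
    state R :=
  2^-1 *: (F Um + F Up - alpha *: (Up - Um)).

End Equations.

(* The cells of the domain are those with indices [0 <= i < nx], [0 <= j < ny].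
   Two layers of ghost cells carry moments: the fluxes on the boundary of the
   domain use point values in the first layer, and reconstructing these uses
   the 3 x 3 blocks around the cells of that layer.  Arrays over cells are total
   functions of the integer indices; values beyond the ghost layers are never
   used. *)
Record mesh (R : realType) := Mesh {
  nx : nat; ny : nat;
  orgx : R; orgy : R;
  dx : R; dy : R;
  nx_gt0 : (0 < nx)%N; ny_gt0 : (0 < ny)%N;
  dx_gt0 : 0 < dx; dy_gt0 : 0 < dy }.

Section Mesh.
Variables (R : realType) (M : mesh R).

Definition inner_cell (i j : int) : Prop :=
  0 <= i < (nx M)%:Z /\ 0 <= j < (ny M)%:Z.

Definition mesh_cell (i j : int) : Prop :=
  - 2%:Z <= i < (nx M)%:Z + 2%:Z /\ - 2%:Z <= j < (ny M)%:Z + 2%:Z.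

Definition xc (i : int) : R := orgx M + i%:~R * dx M.
Definition yc (j : int) : R := orgy M + j%:~R * dy M.

Definition cell (i j : int) : set (R * R) :=
  `[xc i - dx M / 2, xc i + dx M / 2] `*`
  `[yc j - dy M / 2, yc j + dy M / 2].

End Mesh.

Section Quadrature.
Variable R : realType.

Definition gw (l : 'I_3) : R := nth 0 [:: 5 / 18; 4 / 9; 5 / 18] l.
Definition gb (l : 'I_3) : R :=
  nth 0 [:: - (Num.sqrt 15 / 10); 0; Num.sqrt 15 / 10] l.
Definition what1 : R := 1 / 12.

Definition Theta : seq (R * R) :=
  [seq (gb l, gb k) | l <- enum 'I_3, k <- enum 'I_3]
  ++ [seq (s, gb l) | s <- [:: 1 / 2; - (1 / 2)], l <- enum 'I_3]
  ++ [seq (gb l, s) | l <- enum 'I_3, s <- [:: 1 / 2; - (1 / 2)]].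

End Quadrature.

(* Position of the cell number [k = 1, ..., 9] of a 3 x 3 block relative to the
   central cell, numbering row by row from the bottom left. *)
Definition blkx (k : nat) : int := (k.-1 %% 3)%:Z - 1.
Definition blky (k : nat) : int := (k.-1 %/ 3)%:Z - 1.

(* Numbers of the cells whose first moments are stored in a 5-column stencil. *)
Definition momcell (q : 'I_5) : nat := nth 0%N [:: 2; 4; 5; 6; 8] q.
Definition momctr : 'I_5 := @Ordinal 5 2 isT.

Record hweno_param (R : realType) := HwenoParam {
  lw : 'I_5 -> R;
  weps : R;
  lw_gt0 : forall n, 0 < lw n;
  lw_sum1 : \sum_(n < 5) lw n = 1;
  weps_gt0 : 0 < weps }.

Section Reconstruction.
Variables (R : realType) (M : mesh R) (H : hweno_param R).

Local Notation poly2 := (mpoly 2 R).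
Local Notation mu2 := (lebesgue_measure \x lebesgue_measure)%E.

Definition peval (P : poly2) (x y : R) : R :=
  meval (fun c : 'I_2 => if c == ord0 then x else y) P.

Definition pdiff (l1 l2 : nat) (P : poly2) : poly2 :=
  iter l1 (mderiv ord0) (iter l2 (mderiv ord_max) P).

Definition total_degree_le (d : nat) (P : poly2) : Prop :=
  (msize P <= d.+1)%N.

Definition cell_integral (i j : int) (f : R -> R -> R) : R :=
  \int[mu2]_(z in cell M i j) f z.1 z.2.

Definition cell_average (i j : int) (P : poly2) : R :=
  (dx M * dy M)^-1 * cell_integral i j (peval P).

Definition cell_momentx (i j : int) (P : poly2) : R :=
  (dx M * dy M)^-1 *
  cell_integral i j (fun x y => peval P x y * ((x - xc M i) / dx M)).

Definition cell_momenty (i j : int) (P : poly2) : R :=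
  (dx M * dy M)^-1 *
  cell_integral i j (fun x y => peval P x y * ((y - yc M j) / dy M)).

Section Candidates.
Variables (i j : int) (u : 'rV[R]_9) (v w : 'rV[R]_5).

(* [average_ok P k]: the average of [P] on the block cell number [k + 1]. *)
Definition average_ok (P : poly2) (k : 'I_9) : Prop :=
  cell_average (i + blkx k.+1) (j + blky k.+1) P = u 0 k.

Definition central_moments_ok (P : poly2) : Prop :=
  cell_momentx i j P = v 0 momctr /\ cell_momenty i j P = w 0 momctr.

Definition P0_constraints (P : poly2) : Prop :=
  [/\ total_degree_le 4 P, forall k, average_ok P k & central_moments_ok P].

Definition moment_mismatch (P : poly2) : R :=
  \sum_(q < 5 | q != momctr)
    let i' := i + blkx (momcell q) in
    let j' := j + blky (momcell q) in
    ((cell_momentx i' j' P - v 0 q) ^+ 2 + (cell_momenty i' j' P - w 0 q) ^+ 2).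

Definition is_P0 (P : poly2) : Prop :=
  P0_constraints P /\
  forall Q, P0_constraints Q -> moment_mismatch P <= moment_mismatch Q.

Definition is_quadratic (ks : seq nat) (P : poly2) : Prop :=
  [/\ total_degree_le 2 P,
      forall k : 'I_9, k.+1 \in ks -> average_ok P k &
      central_moments_ok P].

Definition is_candidate (n : 'I_5) (P : poly2) : Prop :=
  match val n with
  | 0 => is_P0 P
  | 1 => is_quadratic [:: 1; 2; 4; 5]%N P
  | 2 => is_quadratic [:: 2; 3; 5; 6]%N P
  | 3 => is_quadratic [:: 4; 5; 7; 8]%N P
  | _ => is_quadratic [:: 5; 6; 8; 9]%N P
  end.

(* In every case the conditions have exactly one solution, so the default [0] is
   never taken. *)
Definition cand (n : 'I_5) : poly2 := xget 0 [set P | is_candidate n P].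

Definition cand_degree (n : 'I_5) : nat := if n == ord0 then 4%N else 2%N.

Definition smoothness (n : 'I_5) : R :=
  let r := cand_degree n in
  \sum_(l1 < r.+1) \sum_(l2 < r.+1 | (1 <= l1 + l2 <= r)%N)
    (dx M * dy M) ^+ (l1 + l2).-1 *
    cell_integral i j (fun x y => peval (pdiff l1 l2 (cand n)) x y ^+ 2).

Definition tau : R :=
  4^-1 * \sum_(n < 5) `|smoothness ord0 - smoothness n|.

Definition wbar (n : 'I_5) : R :=
  lw H n * (1 + tau ^+ 2 / (smoothness n ^+ 2 + weps H)).

Definition wH (n : 'I_5) : R := wbar n / \sum_(k < 5) wbar k.

Definition PH : poly2 :=
  wH ord0 *: ((lw H ord0)^-1 *: cand ord0
              - \sum_(n < 5 | n != ord0) (lw H n / lw H ord0) *: cand n)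
  + \sum_(n < 5 | n != ord0) wH n *: cand n.

Definition sML (xi eta : R) : R :=
  peval (cand ord0) (xc M i + xi * dx M) (yc M j + eta * dy M).

Definition sMH (xi eta : R) : R :=
  peval PH (xc M i + xi * dx M) (yc M j + eta * dy M).

End Candidates.

Definition ML (i j : int) (US : 'M[R]_(4, 9)) (VS WS : 'M[R]_(4, 5))
    (xi eta : R) : 'cV[R]_4 :=
  \col_(c < 4) sML i j (row c US) (row c VS) (row c WS) xi eta.

Definition MH (i j : int) (US : 'M[R]_(4, 9)) (VS WS : 'M[R]_(4, 5))
    (xi eta : R) : 'cV[R]_4 :=
  \col_(c < 4) sMH i j (row c US) (row c VS) (row c WS) xi eta.

Definition average_stencil (Z : int -> int -> state R) (i j : int) :
    'M[R]_(4, 9) :=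
  \matrix_(c < 4, k < 9) Z (i + blkx k.+1) (j + blky k.+1) 0 c.

Definition moment_stencil (Z : int -> int -> state R) (i j : int) :
    'M[R]_(4, 5) :=
  \matrix_(c < 4, q < 5) Z (i + blkx (momcell q)) (j + blky (momcell q)) 0 c.

(* [V], [W] are the first moments after modification in the troubled cells;
   [R1 i j], [R2 i j] are the eigenvector matrices at the interfaces
   (i + 1/2, j) and (i, j + 1/2).  Intended for [(a, b)] in [Theta]. *)
Definition reconstruct (troubled : int -> int -> bool)
    (Ubar V W : int -> int -> state R) (R1 R2 : int -> int -> 'M[R]_4)
    (i j : int) (a b : R) : state R :=
  let US := average_stencil Ubar i j in
  let VS := moment_stencil V i j in
  let WS := moment_stencil W i j in
  let linear := ML i j US VS WS a b in
  let nonlinear (P : 'M[R]_4) :=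
    P *m MH i j (invmx P *m US) (invmx P *m VS) (invmx P *m WS) a b in
  (if ~~ troubled i j then linear
   else if a == 1 / 2 then nonlinear (R1 i j)
   else if a == - (1 / 2) then nonlinear (R1 (i - 1) j)
   else if b == 1 / 2 then nonlinear (R2 i j)
   else if b == - (1 / 2) then nonlinear (R2 i (j - 1))
   else linear)^T.

End Reconstruction.

Section Limiter.
Variables (R : realType) (M : mesh R).
Variables (mu1 mu2 : R) (Ubar : int -> int -> state R).
Variable (Ustar : int -> int -> R -> R -> state R).

Definition PiAvg (V : lmodType R) (Zbar : V) (Z : R -> R -> V) : V :=
  (1 - 2 * what1 R)^-1 *:
  (Zbar - \sum_(l < 3) (gw R l * what1 R) *:
     (mu1 *: (Z (1 / 2) (gb R l) + Z (- (1 / 2)) (gb R l))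
      + mu2 *: (Z (gb R l) (1 / 2) + Z (gb R l) (- (1 / 2))))).

(* The minimum of [10^-13] and of [q] over all cells, ghost cells included. *)
Definition min_over_cells (q : state R -> R) : R :=
  \big[Num.min/10 ^- 13]_(i < (nx M + 4)%N)
    \big[Num.min/10 ^- 13]_(j < (ny M + 4)%N)
      q (Ubar (i%:Z - 2%:Z) (j%:Z - 2%:Z)).

Definition epsD : R := min_over_cells (fun U => U 0 cD).
Definition epsg : R := min_over_cells (@g R).

(* The test is needed because [x / 0 = 0] in the library. *)
Definition theta (qbar eps qmin : R) : R :=
  if qbar - qmin == 0 then 1
  else Num.min `|(qbar - eps) / (qbar - qmin)| 1.

Section Cell.
Variables i j : int.

Definition Dbar : R := Ubar i j 0 cD.

Definition Dmin : R :=
  \big[Num.min/PiAvg (Dbar : R^o) (fun a b => Ustar i j a b 0 cD : R^o)]_(z <- Theta R)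
    Ustar i j z.1 z.2 0 cD.

Definition Dtilde (a b : R) : R :=
  theta Dbar epsD Dmin * (Ustar i j a b 0 cD - Dbar) + Dbar.

Definition Utilde (a b : R) : state R :=
  let U := Ustar i j a b in
  mkstate (Dtilde a b) (U 0 cm1) (U 0 cm2) (U 0 cE).

Definition gmin : R :=
  \big[Num.min/g (PiAvg (Ubar i j) Utilde)]_(z <- Theta R) g (Utilde z.1 z.2).

Definition pcp_limit (a b : R) : state R :=
  theta (g (Ubar i j)) epsg gmin *: (Utilde a b - Ubar i j) + Ubar i j.

End Cell.
End Limiter.

Section Scheme.
Variables (R : realType) (gamma : R) (M : mesh R) (alpha1 alpha2 : R).
Variable (U : int -> int -> R -> R -> state R).

(* [num_flux1 i j l] is located at (i + 1/2, j + b_l), [num_flux2 i j l] at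
   (i + b_l, j + 1/2). *)
Definition num_flux1 (i j : int) (l : 'I_3) : state R :=
  lax_friedrichs (flux1 gamma) alpha1
    (U i j (1 / 2) (gb R l)) (U (i + 1) j (- (1 / 2)) (gb R l)).

Definition num_flux2 (i j : int) (l : 'I_3) : state R :=
  lax_friedrichs (flux2 gamma) alpha2
    (U i j (gb R l) (1 / 2)) (U i (j + 1) (gb R l) (- (1 / 2))).

Definition LU (i j : int) : state R :=
  - (\sum_(l < 3) gw R l *:
       ((dx M)^-1 *: (num_flux1 i j l - num_flux1 (i - 1) j l)))
  - \sum_(l < 3) gw R l *:
       ((dy M)^-1 *: (num_flux2 i j l - num_flux2 i (j - 1) l)).

(* The maxima range over the interfaces carrying a flux of the scheme, i.e. the
   sides of the cells of the domain; spectral radii are nonnegative. *)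
Definition max_varrho1 : R :=
  \big[Num.max/0]_(i < (nx M).+1) \big[Num.max/0]_(j < ny M)
  \big[Num.max/0]_(l < 3)
    Num.max (varrho1 gamma (U (i%:Z - 1) j%:Z (1 / 2) (gb R l)))
            (varrho1 gamma (U i%:Z j%:Z (- (1 / 2)) (gb R l))).

Definition max_varrho2 : R :=
  \big[Num.max/0]_(i < nx M) \big[Num.max/0]_(j < (ny M).+1)
  \big[Num.max/0]_(l < 3)
    Num.max (varrho2 gamma (U i%:Z (j%:Z - 1) (gb R l) (1 / 2)))
            (varrho2 gamma (U i%:Z j%:Z (gb R l) (- (1 / 2)))).

End Scheme.

(* Main.v *)
Require Import Defs.
From mathcomp Require Import all_boot all_order all_algebra.
From mathcomp Require Import all_classical all_reals all_analysis.
From mathcomp Require Import complex zify ring lra.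
Set Implicit Arguments.
Unset Strict Implicit.
Unset Printing Implicit Defensive.
Import Order.TTheory GRing.Theory Num.Theory.
Import numFieldNormedType.Exports.
Local Open Scope classical_set_scope.
Local Open Scope ring_scope.

                                                                              
                                                                                 
                                                                              
                

                                                                         
                                                                
                                                                              
                                                                  
                                                                        
                                                                              
                                                                       
                                                                                
                

                                     

(** The set [G] is a convex cone, because [g] is superadditive and homogeneous of degree one. It
    therefore suffices to write the updated average as a combination of members of [G] with
    nonnegative coefficients, one of them positive. [convex_decomposition] does this. It uses
    [1 - 2 * what1] times the average [PiAvg] of the limited values, half steps of the states
    [alpha U - F(U)] and [alpha U + F(U)] taken at the traces on the faces, and the traces inside
    the cell with coefficients [what1 * mu - lambda * alpha]. These last coefficients are
    nonnegative by the CFL condition: with [S = lambda1 * alpha1 + lambda2 * alpha2], each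
    [lambda * alpha] equals [S * mu], and [S <= what1].

    The traces and [PiAvg] lie in [G] by the limiter. Each of its two steps contracts towards the
    cell average just enough for positivity, and [PiAvg], an affine combination, commutes with such
    contractions ([pcp_limit_admissible], [PiAvg_pcp_limit_admissible]).

    The analytic core is [lax_friedrichs_splitting]: [a U - F(U)] and [a U + F(U)] are in [G] as
    soon as [a] is at least the spectral radius of the Jacobian of [F] at [U]. The pressure is the
    only positive root of the scalar equation [pressure_eq], and implicit differentiation gives the
    differential of the flux. An explicit eigenvector then shows that both roots of the acoustic
    quadratic [wave_poly] are eigenvalues ([flux_eigenvalue]), so they lie between [-a] and [a].
    Outside the two roots [wave_poly] is nonnegative, and an algebraic identity
    ([shifted_state_subluminal]) turns this into the quadratic inequality of the cone for
    [b U - F(U)]. The energy of that state cannot vanish on the half-line beyond a root, which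
    settles its sign ([shifted_state_admissible]). *)

(** * Differentiability in Caratheodory's form, and implicit differentiation *)

Section Slopes.
Variables (R : realType) (T : topologicalType) (x0 : T).
Implicit Types (I : finType) (h : T -> R).

                                                                                
                                                                             
                                                                              
                                                
(** Caratheodory's differentiability at [x0]: the increment of [h] is a combination of the
    increments of the [phi k], with coefficients continuous at [x0], and [e] is the resulting linear
    form. The [phi k] need not be coordinates. The pressure can thus serve as one more variable
    before it is known to be differentiable. *)
Definition has_slope I (phi : T -> I -> R) h (e : (I -> R) -> R) : Prop :=
  exists (c : I -> T -> R) (d : I -> R),
  [/\ forall k, c k x @[x --> x0] --> d k,
      \forall x \near x0, h x - h x0 = \sum_k c k x * (phi x k - phi x0 k) &
      forall r, e r = \sum_k d k * r k].

Lemma slope_continuous I (phi : T -> I -> R) h e :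
  (forall k, phi x k @[x --> x0] --> phi x0 k) ->
  has_slope phi h e -> h x @[x --> x0] --> h x0.
Proof.
move=> phic [c [d [cd hE _]]].
have l0 : h x0 + \sum_k c k x * (phi x k - phi x0 k) @[x --> x0] --> h x0.
  rewrite -[X in _ --> X]addr0; apply: cvgD; first exact: cvg_cst.
  rewrite [X in _ --> X](_ : _ = \sum_k d k * (phi x0 k - phi x0 k)); last first.
    by rewrite big1// => k _; rewrite subrr mulr0.
  apply: (cvg_big add_continuous) => // k _.
  by apply: cvgM => //; apply: cvgB => //; exact: cvg_cst.
apply: cvg_trans l0; apply: near_eq_cvg.
by near=> x; rewrite -(near hE x)// addrC subrK.
Unshelve. all: by end_near. Qed.

Lemma slope_cst I (phi : T -> I -> R) (a : R) : has_slope phi (fun=> a) (fun=> 0).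
Proof.
exists (fun _ _ => 0), (fun=> 0); split=> [k||r]; first exact: cvg_cst.
  by apply: nearW => x; rewrite subrr big1// => k _; rewrite mul0r.
by rewrite big1// => k _; rewrite mul0r.
Qed.

Lemma slope_coord I (phi : T -> I -> R) k :
  has_slope phi (fun x => phi x k) (fun r => r k).
Proof.
exists (fun l _ => (l == k)%:R), (fun l => (l == k)%:R).
have sumE (f : I -> R) : \sum_l (l == k)%:R * f l = f k.
  by rewrite (bigD1 k)//= eqxx mul1r big1 ?addr0// => l /negPf->; rewrite mul0r.
split=> [l||r]; first exact: cvg_cst; last by rewrite sumE.
by apply: nearW => x; rewrite (sumE (fun l => phi x l - phi x0 l)).
Qed.

Lemma slopeD I (phi : T -> I -> R) h1 h2 e1 e2 :
  has_slope phi h1 e1 -> has_slope phi h2 e2 ->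
  has_slope phi (fun x => h1 x + h2 x) (fun r => e1 r + e2 r).
Proof.
move=> [c1 [d1 [cd1 h1E e1E]]] [c2 [d2 [cd2 h2E e2E]]].
exists (fun k x => c1 k x + c2 k x), (fun k => d1 k + d2 k); split=> [k||r].
- exact: cvgD.
- near=> x; rewrite opprD addrACA (near h1E x)// (near h2E x)// -big_split/=.
  by apply: eq_bigr => k _; rewrite mulrDl.
- by rewrite e1E e2E -big_split/=; apply: eq_bigr => k _; rewrite mulrDl.
Unshelve. all: by end_near. Qed.

Lemma slopeM I (phi : T -> I -> R) h1 h2 e1 e2 :
  (forall k, phi x k @[x --> x0] --> phi x0 k) ->
  has_slope phi h1 e1 -> has_slope phi h2 e2 ->
  has_slope phi (fun x => h1 x * h2 x) (fun r => e1 r * h2 x0 + h1 x0 * e2 r).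
Proof.
move=> phic s1 s2; have h2c := slope_continuous phic s2.
move: s1 s2 => [c1 [d1 [cd1 h1E e1E]]] [c2 [d2 [cd2 h2E e2E]]].
exists (fun k x => c1 k x * h2 x + h1 x0 * c2 k x),
  (fun k => d1 k * h2 x0 + h1 x0 * d2 k); split=> [k||r].
- by apply: cvgD; apply: cvgM => //; exact: cvg_cst.
- near=> x; transitivity ((h1 x - h1 x0) * h2 x + h1 x0 * (h2 x - h2 x0)); first ring.
  rewrite (near h1E x)// (near h2E x)// mulr_suml mulr_sumr -big_split/=.
  by apply: eq_bigr => k _; ring.
- rewrite e1E e2E mulr_suml mulr_sumr -big_split/=.
  by apply: eq_bigr => k _; ring.
Unshelve. all: by end_near. Qed.

Lemma slopeN I (phi : T -> I -> R) h e :
  has_slope phi h e -> has_slope phi (fun x => - h x) (fun r => - e r).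
Proof.
move=> [c [d [cd hE eE]]].
exists (fun k x => - c k x), (fun k => - d k); split=> [k||r].
- exact: cvgN.
- near=> x; rewrite -opprD (near hE x)// -sumrN.
  by apply: eq_bigr => k _; rewrite mulNr.
- by rewrite eE -sumrN; apply: eq_bigr => k _; rewrite mulNr.
Unshelve. all: by end_near. Qed.

Lemma slopeV I (phi : T -> I -> R) h e :
  (forall k, phi x k @[x --> x0] --> phi x0 k) -> h x0 != 0 ->
  has_slope phi h e ->
  has_slope phi (fun x => (h x)^-1) (fun r => - e r / h x0 ^+ 2).
Proof.
move=> phic hn0 s; have hc := slope_continuous phic s.
move: s => [c [d [cd hE eE]]].
exists (fun k x => - c k x / (h x * h x0)), (fun k => - d k / (h x0 * h x0)).
split=> [k||r].
- apply: cvgM; first exact: cvgN.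
  by apply: cvgV; [rewrite mulf_neq0|apply: cvgM => //; exact: cvg_cst].
- have hx0 : \forall x \near x0, h x != 0 by exact: (cvgr_neq0 _ hc).
  near=> x; have hxn0 : h x != 0 by near: x.
  transitivity (- (h x - h x0) / (h x * h x0)).
    by field; rewrite hxn0 hn0.
  rewrite (near hE x)// -sumrN mulr_suml.
  by apply: eq_bigr => k _; ring.
- rewrite eE -sumrN mulr_suml; apply: eq_bigr => k _.
  by rewrite expr2; ring.
Unshelve. all: by end_near. Qed.

Lemma slope_sqrt I (phi : T -> I -> R) h e :
  (forall k, phi x k @[x --> x0] --> phi x0 k) -> 0 < h x0 ->
  has_slope phi h e ->
  has_slope phi (fun x => Num.sqrt (h x)) (fun r => e r / (2 * Num.sqrt (h x0))).
Proof.
move=> phic h0 s; have hc := slope_continuous phic s.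
have s0 : 0 < Num.sqrt (h x0) by rewrite sqrtr_gt0.
have sc : Num.sqrt (h x) @[x --> x0] --> Num.sqrt (h x0).
  exact: (cvg_comp _ _ hc (@sqrt_continuous R (h x0))).
move: s => [c [d [cd hE eE]]].
exists (fun k x => c k x / (Num.sqrt (h x) + Num.sqrt (h x0))),
  (fun k => d k / (2 * Num.sqrt (h x0))).
split=> [k||r].
- apply: cvgM => //; apply: cvgV; first by rewrite gt_eqF// mulr_gt0.
  by rewrite mulr_natl mulr2n; apply: cvgD => //; exact: cvg_cst.
- have hx0 : \forall x \near x0, 0 < h x by exact: (cvgr_gt _ hc).
  near=> x; have hx : 0 < h x by near: x.
  have sx : 0 < Num.sqrt (h x) by rewrite sqrtr_gt0.
  transitivity ((h x - h x0) / (Num.sqrt (h x) + Num.sqrt (h x0))).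
    rewrite -[in h x - _](sqr_sqrtr (ltW hx)) -[in _ - h x0](sqr_sqrtr (ltW h0)).
    by field; rewrite gt_eqF// addr_gt0.
  by rewrite (near hE x)// mulr_suml; apply: eq_bigr => k _; ring.
- by rewrite eE mulr_suml; apply: eq_bigr => k _; ring.
Unshelve. all: by end_near. Qed.

Definition ocons (I : Type) (a : R) (r : I -> R) (o : option I) : R :=
  oapp r a o.

Lemma sum_option I (f : option I -> R) : \sum_o f o = f None + \sum_k f (Some k).
Proof.
rewrite (bigD1 None)//=; congr (_ + _).
rewrite (reindex_omap Some id)//=; last by case.
by apply: eq_bigl => k; rewrite eqxx.
Qed.

(** Near [x0] the increment of [f] is zero, so its expansion can be solved for the increment of [p].
    The coefficient to divide by is nonzero near [x0], since its limit is the partial slope of [f]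
    in [p]. *)
Lemma implicit_slope I (phi : T -> I -> R) (p f : T -> R) e :
  p x @[x --> x0] --> p x0 ->
  has_slope (fun x => ocons (p x) (phi x)) f e ->
  (\forall x \near x0, f x = f x0) ->
  e (ocons 1 (fun=> 0)) != 0 ->
  exists2 dp, has_slope phi p dp & forall r, e (ocons (dp r) r) = 0.
Proof.
move=> pc [c [d [cd fE eE]]] f0.
have -> : e (ocons 1 (fun=> 0)) = d None.
  by rewrite eE sum_option/= mulr1 big1 ?addr0// => k _; rewrite mulr0.
move=> dn0; exists (fun r => \sum_k (- d (Some k) / d None) * r k); last first.
  move=> r; rewrite eE sum_option/= mulr_sumr -big_split/= big1// => k _.
  by field.
exists (fun k x => - c (Some k) x / c None x), (fun k => - d (Some k) / d None).
split=> // [k|]; first by apply: cvgM; [exact: cvgN|exact: cvgV].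
have cn0 : \forall x \near x0, c None x != 0 by exact: (cvgr_neq0 _ (cd None)).
near=> x; have cx : c None x != 0 by near: x.
have : f x - f x0 = \sum_o c o x * (ocons (p x) (phi x) o - ocons (p x0) (phi x0) o).
  by near: x.
have -> : f x = f x0 by near: x.
rewrite subrr sum_option/ocons/=.
have -> : \sum_k - c (Some k) x / c None x * (phi x k - phi x0 k) =
  - (c None x)^-1 * \sum_k c (Some k) x * (phi x k - phi x0 k).
  by rewrite mulr_sumr; apply: eq_bigr => k _; ring.
set S := \sum_k _ => E; apply: (mulfI cx).
by rewrite mulrA mulrN divff// mulN1r; apply/eqP; rewrite -addr_eq0 -E.
Unshelve. all: by end_near. Qed.

End Slopes.

Lemma norm_rV_le (R : realType) n (v : 'rV[R]_n) a :
  0 <= a -> (forall j, `|v 0 j| <= a) -> `|v| <= a.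
Proof.
move=> a0 va; rewrite [`|v|]mx_normrE; apply: bigmax_le => // -[i j] _ /=.
by rewrite ord1.
Qed.

Lemma coord_rV_le (R : realType) n (v : 'rV[R]_n) j : `|v 0 j| <= `|v|.
Proof. by rewrite [`|v|]mx_normrE; exact: (le_bigmax _ _ (0, j)). Qed.

(** From Caratheodory to Frechet: with [r] the increment, the remainder is the sum of
    [(c k x - d k) * r k], whose coefficients tend to zero, hence it is small compared with the norm
    of [r]. *)
Lemma slope_differentiable (R : realType) n m (F : 'rV[R]_n.+1 -> 'rV[R]_m.+1) U0
    (e : 'I_m.+1 -> ('I_n.+1 -> R) -> R) :
  (forall j, has_slope U0 (fun (U : 'rV[R]_n.+1) k => U 0 k) (fun U => F U 0 j) (e j)) ->
  differentiable F U0 /\ forall r j, 'd F U0 r 0 j = e j (fun k => r 0 k).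
Proof.
move=> /choice[c] /choice[d] H.
pose L : 'M[R]_(n.+1, m.+1) := \matrix_(k, j) d j k.
pose dF : {linear 'rV[R]_n.+1 -> 'rV[R]_m.+1} := mulmxr L.
have dFE r j : dF r 0 j = e j (fun k => r 0 k).
  have [_ _ ->] := H j; rewrite /= mxE; apply: eq_bigr => k _.
  by rewrite mxE mulrC.
have dFc : continuous dF.
  move=> r; have rF := nbhs_filter r; apply/(@cvgrPdist_le _ _ _ _ rF) => eps eps0.
  have dFjc j : dF x 0 j @[x --> r] --> dF r 0 j.
    rewrite dFE; have [_ _ ->] := H j.
    have -> : (fun x => dF x 0 j) = (fun x : 'rV[R]_n.+1 => \sum_k d j k * x 0 k).
      by apply/funext => x; rewrite dFE; have [_ _ ->] := H j.
    apply: (cvg_big add_continuous) => // k _.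
    by apply: cvgM; [exact: cvg_cst|exact: coord_continuous].
  have : \forall x \near r, forall j, `|dF r 0 j - dF x 0 j| <= eps.
    by apply: (filter_forall rF) => j; exact: (cvgrPdist_le _ _).1.
  apply: filterS => x le_eps; apply: norm_rV_le; first exact: ltW.
  move=> j; rewrite (_ : (dF r - dF x) 0 j = dF r 0 j - dF x 0 j) //.
  by rewrite [LHS]mxE [X in _ + X]mxE.
pose V : normedModType R := 'rV[R]_n.+1; pose W : normedModType R := 'rV[R]_m.+1.
have FE : (F : V -> W) \o shift (U0 : V) = cst (F U0 : W) + dF +o_ (0 : V) id.
  apply/eqaddoP => eps eps0.
  have nearc : \forall x \near U0, forall j k, `|c j k x - d j k| <= eps / n.+1%:R.
    apply: (filter_forall (nbhs_filter U0)) => j.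
    apply: (filter_forall (nbhs_filter U0)) => k.
    have [cd _ _] := H j.
    have := (@cvgrPdist_le _ _ _ _ (nbhs_filter U0) _ _).1 (cd k) _ (divr_gt0 eps0 (ltr0Sn _ n)).
    by apply: filterS => x; rewrite distrC.
  have nearF : \forall x \near U0, forall j, F x 0 j - F U0 0 j =
      \sum_k c j k x * (x 0 k - U0 0 k).
    by apply: (filter_forall (nbhs_filter U0)) => j; have [_ ? _] := H j.
  suff: \forall x \near (U0 : V), `|F x - (F U0 + dF (x - U0))| <= eps * `|x - U0|.
    rewrite (near_shift (0 : V)) subr0; apply: filterS => z /=.
    by rewrite addrK.
  near=> x; set r := x - U0.
  apply: norm_rV_le; first by rewrite mulr_ge0// ltW.
  move=> j; have -> : (F x - (F U0 + dF r)) 0 j =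
      \sum_k (c j k x - d j k) * r 0 k.
    have [_ _ eE] := H j.
    transitivity (F x 0 j - F U0 0 j - dF r 0 j); first by rewrite !mxE; ring.
    rewrite dFE eE (near nearF x)// -sumrB; apply: eq_bigr => k _.
    by rewrite !mxE; ring.
  apply: (le_trans (ler_norm_sum _ _ _)).
  apply: (@le_trans _ _ (\sum_(k < n.+1) eps / n.+1%:R * `|r|)).
    apply: ler_sum => k _; rewrite normrM ler_pM// ?coord_rV_le//.
    by have := near nearc x; apply.
  by rewrite sumr_const card_ord -mulr_natl le_eqVlt; apply/orP; left; apply/eqP; field.
have dE := diff_unique dFc FE.
split; last by move=> r j; rewrite dE dFE.
by apply/diff_locallyP; rewrite dE.
Unshelve. all: by end_near. Qed.

Lemma slope_ext (R : realType) (T : topologicalType) (x0 : T) (I : finType)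
    (phi : T -> I -> R) h h' e e' :
  has_slope x0 phi h e -> (\forall x \near x0, h x = h' x) -> e =1 e' ->
  has_slope x0 phi h' e'.
Proof.
move=> [c [d [cd hE eE]]] hh' ee'; exists c, d; split=> // [|r].
  by rewrite -(nbhs_singleton hh'); near=> x; rewrite -(near hh' x)// (near hE x).
by rewrite -ee'.
Unshelve. all: by end_near. Qed.

                              

(** * The scalar equation that determines the pressure *)

Section PressureEquation.
Variable R : realType.
Implicit Types D m n E p A k : R.

Definition inv_lorentz2 m n A : R := 1 - (m / A * (m / A) + n / A * (n / A)).

(** Put [A = E + p = D h W], so that the velocity is [(m / A, n / A)] and [inv_lorentz2] is
    [1 / W^2]. Then [rho = D / W], and [A / W^2 = rho h = rho + k p] with [k = gamma / (gamma - 1)].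
    The primitive variables correspond to the positive zeros in [p]. *)
Definition pressure_eq k D m n E p : R :=
  (E + p) * inv_lorentz2 m n (E + p)
  - D * Num.sqrt (inv_lorentz2 m n (E + p)) - k * p.

(** The differential of [pressure_eq] applied to a direction; [ds2] is the variation of
    [1 / W^2]. *)
Definition pressure_eq_diff k D m n E p (dD dm dn dE dp : R) : R :=
  let A := E + p in let v := m / A in let w := n / A in
  let s2 := inv_lorentz2 m n A in let dA := dE + dp in
  let ds2 := - 2 * (v * ((dm - v * dA) / A) + w * ((dn - w * dA) / A)) in
  dA * s2 + A * ds2 - (dD * Num.sqrt s2 + D * (ds2 / (2 * Num.sqrt s2))) - k * dp.

Lemma slope_pressure_eq k (T : topologicalType) (x0 : T) (I : finType)
    (phi : T -> I -> R) (D m n E p : T -> R) (eD em en eE ep : (I -> R) -> R) :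
  (forall i, phi x i @[x --> x0] --> phi x0 i) ->
  has_slope x0 phi D eD -> has_slope x0 phi m em -> has_slope x0 phi n en ->
  has_slope x0 phi E eE -> has_slope x0 phi p ep ->
  E x0 + p x0 != 0 -> 0 < inv_lorentz2 (m x0) (n x0) (E x0 + p x0) ->
  has_slope x0 phi (fun x => pressure_eq k (D x) (m x) (n x) (E x) (p x))
    (fun r => pressure_eq_diff k (D x0) (m x0) (n x0) (E x0) (p x0)
                (eD r) (em r) (en r) (eE r) (ep r)).
Proof.
move=> phic sD sm sn sE sp A0 s0.
have sA := slopeD sE sp.
have sV := slopeV phic A0 sA.
have sv := slopeM phic sm sV.
have sw := slopeM phic sn sV.
have sl : has_slope x0 phi (fun x => inv_lorentz2 (m x) (n x) (E x + p x)) _ :=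
  slopeD (slope_cst x0 phi 1) (slopeN (slopeD (slopeM phic sv sv) (slopeM phic sw sw))).
have ss := slope_sqrt phic s0 sl.
apply: (slope_ext
  (slopeD (slopeD (slopeM phic sA sl) (slopeN (slopeM phic sD ss)))
     (slopeN (slopeM phic (slope_cst x0 phi k) sp)))); first exact: nearW.
move=> r; rewrite /pressure_eq_diff /=.
have q0 : Num.sqrt (inv_lorentz2 (m x0) (n x0) (E x0 + p x0)) != 0.
  by rewrite gt_eqF// sqrtr_gt0.
by field; rewrite A0 q0.
Qed.

Section Root.
Variables (k D m n E : R).
Hypotheses (k_ge2 : 2 <= k) (D_gt0 : 0 < D) (E_gt0 : 0 < E).
Hypothesis subluminal : D ^+ 2 + m ^+ 2 + n ^+ 2 < E ^+ 2.

Lemma inv_lorentz2_gt0 A : E <= A -> 0 < inv_lorentz2 m n A.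
Proof.
move=> EA; have A0 : 0 < A by exact: lt_le_trans EA.
have -> : inv_lorentz2 m n A = (A ^+ 2 - (m ^+ 2 + n ^+ 2)) / A ^+ 2.
  by rewrite /inv_lorentz2; field; rewrite gt_eqF.
rewrite divr_gt0// ?exprn_gt0//.
have : E ^+ 2 <= A ^+ 2 by rewrite ler_sqr ?nnegrE ?(ltW E_gt0) ?(ltW A0)//.
have : 0 < D ^+ 2 by rewrite exprn_gt0.
by move: subluminal; lra.
Qed.

(** The first term is [A - (m^2 + n^2) / A]. Its increment is less than [2 (q - p)] because
    [m^2 + n^2] is below the product of the two values of [A], and [k >= 2] absorbs it. The Lorentz
    root increases with [p], so the term in [D] only helps. *)
Lemma pressure_eq_decreasing p q :
  0 <= p -> p < q -> pressure_eq k D m n E q < pressure_eq k D m n E p.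
Proof.
move=> p0 pq; rewrite /pressure_eq; move: (E_gt0) (k_ge2) => E0 k2.
have Ap : 0 < E + p by lra.
have Aq : 0 < E + q by lra.
have MA : (m ^+ 2 + n ^+ 2) / ((E + p) * (E + q)) < 1.
  rewrite ltr_pdivrMr ?mulr_gt0// mul1r.
  have : 0 < D ^+ 2 by rewrite exprn_gt0.
  have : E * E <= (E + p) * (E + q) by apply: ler_pM; lra.
  by move: subluminal; rewrite expr2; lra.
have M0 : 0 <= (m ^+ 2 + n ^+ 2) / ((E + p) * (E + q)).
  by rewrite divr_ge0 ?addr_ge0 ?sqr_ge0// mulr_ge0// ltW.
have lE : (E + q) * inv_lorentz2 m n (E + q) - (E + p) * inv_lorentz2 m n (E + p) =
    (q - p) * (1 + (m ^+ 2 + n ^+ 2) / ((E + p) * (E + q))).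
  by rewrite /inv_lorentz2; field; rewrite !gt_eqF.
have l_lt : (q - p) * (1 + (m ^+ 2 + n ^+ 2) / ((E + p) * (E + q))) < k * (q - p).
  rewrite mulrC ltr_pM2r ?subr_gt0//.
  move: MA M0; set X := _ / _; lra.
have s_le : Num.sqrt (inv_lorentz2 m n (E + p)) <= Num.sqrt (inv_lorentz2 m n (E + q)).
  have lq : 0 < inv_lorentz2 m n (E + q) by apply: inv_lorentz2_gt0; lra.
  rewrite ler_sqrt ?(ltW lq)//.
  rewrite -subr_ge0.
  have -> : inv_lorentz2 m n (E + q) - inv_lorentz2 m n (E + p) =
    (q - p) * ((E + q) + (E + p)) / (E + q) ^+ 2 / (E + p) ^+ 2 * (m ^+ 2 + n ^+ 2).
    by rewrite /inv_lorentz2; field; rewrite !gt_eqF.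
  rewrite mulr_ge0 ?addr_ge0 ?sqr_ge0// !divr_ge0 ?sqr_ge0// mulr_ge0//; lra.
have Ds : D * Num.sqrt (inv_lorentz2 m n (E + p)) <= D * Num.sqrt (inv_lorentz2 m n (E + q)).
  by rewrite ler_pM2l.
lra.
Qed.

Lemma pressure_eq_inj p q : 0 <= p -> 0 <= q ->
  pressure_eq k D m n E p = pressure_eq k D m n E q -> p = q.
Proof.
move=> p0 q0 pq; apply/eqP; rewrite eq_le !leNgt; apply/andP; split.
  by apply/negP => /(pressure_eq_decreasing q0); rewrite pq ltxx.
by apply/negP => /(pressure_eq_decreasing p0); rewrite pq ltxx.
Qed.

(** Intermediate values on [[0, E]]. At [0] the function is [s (E s - D)] with
    [E s = sqrt (E^2 - m^2 - n^2) > D]. At [E] it is below [2 E - k E <= 0]. *)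
Lemma pressure_eq_root : exists2 p, 0 < p & pressure_eq k D m n E p = 0.
Proof.
move: (E_gt0) (k_ge2) (subluminal) (D_gt0) => E0 k2 DE D0.
have f0 : 0 < pressure_eq k D m n E 0.
  have l0 := inv_lorentz2_gt0 (lexx E).
  rewrite /pressure_eq mulr0 subr0 addr0 -[in E * _](sqr_sqrtr (ltW l0)) expr2 mulrA -mulrBl.
  rewrite mulr_gt0 ?sqrtr_gt0// subr_gt0.
  rewrite -ltr_sqr ?nnegrE ?mulr_ge0 ?sqrtr_ge0 ?ltW// exprMn sqr_sqrtr ?ltW//.
  have -> : E ^+ 2 * inv_lorentz2 m n E = E ^+ 2 - (m ^+ 2 + n ^+ 2).
    by rewrite /inv_lorentz2; field; rewrite gt_eqF.
  lra.
have fE : pressure_eq k D m n E E < 0.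
  have EE : 0 < E + E by lra.
  rewrite /pressure_eq.
  have l1 : inv_lorentz2 m n (E + E) <= 1.
    by rewrite /inv_lorentz2 -!expr2 lerBlDr lerDl addr_ge0// sqr_ge0.
  have : (E + E) * inv_lorentz2 m n (E + E) <= (E + E) * 1 by rewrite ler_pM2l.
  have : 0 < D * Num.sqrt (inv_lorentz2 m n (E + E)).
    by rewrite mulr_gt0// sqrtr_gt0 inv_lorentz2_gt0//; lra.
  have : 2 * E <= k * E by rewrite ler_pM2r.
  lra.
have fc : {within `[0, E], continuous (pressure_eq k D m n E)}.
  apply: continuous_in_subspaceT => p /set_mem/=; rewrite in_itv/= => /andP[p0 pE].
  pose phi (x : R) (_ : 'I_1) := x.
  have phic l : phi x l @[x --> p] --> phi p l by exact: cvg_id.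
  apply: (slope_continuous phic).
  apply: (slope_pressure_eq k phic (slope_cst _ _ D) (slope_cst _ _ m)
    (slope_cst _ _ n) (slope_cst _ _ E) (slope_coord _ phi ord0)).
    by rewrite /phi gt_eqF//; lra.
  by rewrite /phi; apply: inv_lorentz2_gt0; lra.
have [|p pI fp] := IVT (ltW E_gt0) fc (v := 0).
  by rewrite ge_min le_max (ltW f0) (ltW fE) orbT.
exists p => //; move: pI; rewrite in_itv/= => /andP[+ _].
by rewrite le_eqVlt => /orP[/eqP p0|//]; move: fp f0; rewrite -p0 => ->; rewrite ltxx.
Qed.

End Root.
End PressureEquation.

                            

(** * Admissible states: openness, primitive variables, continuity of the pressure *)

Section Admissible.
Variable R : realType.
Implicit Types (U : state R).

(** The form without square root; the sign of the energy is the information that squaring loses. *)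
Lemma GP U : G U <-> [/\ 0 < U 0 cD, 0 < U 0 cE &
  U 0 cD ^+ 2 + U 0 cm1 ^+ 2 + U 0 cm2 ^+ 2 < U 0 cE ^+ 2].
Proof.
have S0 : 0 <= U 0 cD ^+ 2 + U 0 cm1 ^+ 2 + U 0 cm2 ^+ 2.
  by rewrite !addr_ge0// sqr_ge0.
rewrite /G /g /=; split=> [[D0]|[D0 E0 lt]].
  rewrite subr_gt0 => SE.
  have E0 : 0 < U 0 cE by apply: le_lt_trans SE; exact: sqrtr_ge0.
  split=> //; rewrite -[ltLHS]sqr_sqrtr// ltr_sqr ?nnegrE ?sqrtr_ge0//.
  exact: ltW.
split=> //; rewrite subr_gt0 -ltr_sqr ?nnegrE ?sqrtr_ge0 ?(ltW E0)//.
by rewrite sqr_sqrtr.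
Qed.

Lemma near_G U : G U -> \forall V \near U, G V.
Proof.
move=> /GP[D0 E0 lt].
have cc c : V 0 c @[V --> U] --> U 0 c by exact: coord_continuous.
have near_D : \forall V \near U, 0 < (V : state R) 0 cD by exact: (cvgr_gt _ (cc cD)).
have near_E : \forall V \near U, 0 < (V : state R) 0 cE by exact: (cvgr_gt _ (cc cE)).
pose phi (V : state R) c := V 0 c.
have lc : phi V cE * phi V cE
    - (phi V cD * phi V cD + phi V cm1 * phi V cm1 + phi V cm2 * phi V cm2)
    @[V --> U] --> U 0 cE * U 0 cE
    - (U 0 cD * U 0 cD + U 0 cm1 * U 0 cm1 + U 0 cm2 * U 0 cm2).
  have sq c := slopeM cc (slope_coord U phi c) (slope_coord U phi c).
  exact: (slope_continuous cc
    (slopeD (sq cE) (slopeN (slopeD (slopeD (sq cD) (sq cm1)) (sq cm2))))).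
move: lt; rewrite -subr_gt0 !expr2 => lt.
have near_l := cvgr_gt _ lc _ lt.
near=> V; apply/GP; split.
- by near: V.
- by near: V.
- by rewrite -subr_gt0 !expr2; near: V; exact: near_l.
Unshelve. all: by end_near. Qed.

Variable gamma : R.
Hypothesis gamma12 : 1 < gamma <= 2.

Definition adiabatic_coef : R := gamma / (gamma - 1).
Local Notation k := adiabatic_coef.

Lemma adiabatic_coef_ge2 : 2 <= k.
Proof. by rewrite /k; move/andP: gamma12 => [g1 g2]; rewrite ler_pdivlMr; lra. Qed.

Definition pressure U : R := (primitive gamma U).2.

Definition state_eq U p : R := pressure_eq k (U 0 cD) (U 0 cm1) (U 0 cm2) (U 0 cE) p.

(** A positive root yields primitive variables by direct computation. Conversely any primitive
    variables of [U] make their own pressure a root, and roots are unique by monotonicity, so the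
    choice made by [xget] is forced. *)
Lemma primitive_root U p : G U -> 0 < p -> state_eq U p = 0 ->
  let A := U 0 cE + p in
  primitive gamma U =
    (U 0 cD * Num.sqrt (inv_lorentz2 (U 0 cm1) (U 0 cm2) A), U 0 cm1 / A, U 0 cm2 / A, p).
Proof.
move=> /GP[D0 E0 lt] p0 fp A; move/andP: (gamma12) => [g1 g2].
have A0 : 0 < A by rewrite addr_gt0.
have := inv_lorentz2_gt0 D0 E0 lt (A := A); rewrite lerDl => /(_ (ltW p0)) l0.
apply: xget_unique => /=.
  have -> : 1 - ((U 0 cm1 / A) ^+ 2 + (U 0 cm2 / A) ^+ 2) =
    inv_lorentz2 (U 0 cm1) (U 0 cm2) A by rewrite /inv_lorentz2 -!expr2.
  move: fp; rewrite /state_eq /pressure_eq -/A -{1}[inv_lorentz2 _ _ _](sqr_sqrtr (ltW l0)).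
  have vE : (U 0 cm1 / A) ^+ 2 + (U 0 cm2 / A) ^+ 2 = 1 - inv_lorentz2 (U 0 cm1) (U 0 cm2) A.
    by rewrite /inv_lorentz2 -!expr2; ring.
  have s0 : 0 < Num.sqrt (inv_lorentz2 (U 0 cm1) (U 0 cm2) A) by rewrite sqrtr_gt0.
  rewrite vE; move: s0 l0; set l := inv_lorentz2 _ _ _; set s := Num.sqrt l.
  move=> s0 l0 fp.
  have hW : U 0 cD * (1 + p / ((gamma - 1) * (U 0 cD * s)) + p / (U 0 cD * s)) * (1 / s) = A.
    have -> : U 0 cD * (1 + p / ((gamma - 1) * (U 0 cD * s)) + p / (U 0 cD * s)) * (1 / s) =
      (U 0 cD * s + k * p) / s ^+ 2.
      by rewrite /k; field; rewrite !gt_eqF// subr_gt0.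
    apply: (canLR (mulfK _)); first by rewrite gt_eqF// exprn_gt0.
    by rewrite -[RHS]subr0 -fp; ring.
  split=> //; first by rewrite mulr_gt0.
    by rewrite -[ltRHS]sqrtr1 ltr_sqrt// ltrBlDr ltrDl.
  rewrite hW; split; first by field; rewrite gt_eqF.
  - by field; rewrite gt_eqF.
  - by field; rewrite gt_eqF.
  - by rewrite /A addrK.
move=> [[[rho v1] v2] q] [rho0 q0 v_lt1] [].
set s := Num.sqrt (1 - _); set h := 1 + _ + _ => DE m1E m2E EE.
have l1 : 0 < 1 - (v1 ^+ 2 + v2 ^+ 2).
  move: v_lt1; rewrite -[ltRHS]sqrtr1 ltr_sqrt// subr_gt0//.
have s0 : 0 < s by rewrite sqrtr_gt0.
have AE : U 0 cE + q = U 0 cD * h * (1 / s) by rewrite EE subrK.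
have Aq : 0 < U 0 cE + q by rewrite addr_gt0.
have v1E : v1 = U 0 cm1 / (U 0 cE + q).
  by rewrite m1E AE mulrC mulKf// -AE gt_eqF.
have v2E : v2 = U 0 cm2 / (U 0 cE + q).
  by rewrite m2E AE mulrC mulKf// -AE gt_eqF.
have lE : inv_lorentz2 (U 0 cm1) (U 0 cm2) (U 0 cE + q) = s ^+ 2.
  by rewrite /s sqr_sqrtr ?ltW// /inv_lorentz2 -v1E -v2E -!expr2.
have pq : p = q.
  apply: (pressure_eq_inj adiabatic_coef_ge2 D0 E0 lt (ltW p0) (ltW q0)).
  rewrite -/(state_eq U p) fp /pressure_eq lE sqrtr_sqr (gtr0_norm s0) AE.
  rewrite /h DE /k; field.
  by rewrite !gt_eqF// subr_gt0.
rewrite /A pq lE sqrtr_sqr (gtr0_norm s0) -v1E -v2E; congr (_, _, _, _).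
by rewrite DE; field; rewrite gt_eqF.
Qed.

Lemma pressureP U : G U -> 0 < pressure U /\ state_eq U (pressure U) = 0.
Proof.
move=> GU; have /GP[D0 E0 lt] := GU.
have [p p0 fp] := pressure_eq_root adiabatic_coef_ge2 D0 E0 lt.
by rewrite /pressure (primitive_root GU p0 fp).
Qed.

(** At a fixed pressure, [state_eq] is continuous in the state. Its opposite signs at
    [pressure U - d] and [pressure U + d] therefore persist for nearby [V], and strict monotonicity
    traps [pressure V] in between. *)
Lemma pressure_continuous U : G U -> pressure V @[V --> U] --> pressure U.
Proof.
move=> GU; have [p0 fp] := pressureP GU; have /GP[D0 E0 lt] := GU.
have state_eq_cvg p : 0 < p -> state_eq V p @[V --> U] --> state_eq U p.
  move=> p_gt0; pose phi (V : state R) c := V 0 c.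
  have phic c : phi V c @[V --> U] --> phi U c by exact: coord_continuous.
  apply: (slope_continuous phic).
  apply: (slope_pressure_eq k phic (slope_coord _ phi cD) (slope_coord _ phi cm1)
    (slope_coord _ phi cm2) (slope_coord _ phi cE) (slope_cst _ _ p)).
    by rewrite /phi gt_eqF// addr_gt0.
  by apply: (inv_lorentz2_gt0 D0 E0 lt); rewrite /phi lerDl ltW.
have UF := nbhs_filter U.
apply/(@cvgrPdist_le _ _ _ _ UF) => e e0.
(* The bound by half the pressure keeps [pressure U - d] positive, where monotonicity is
   available. *)
pose d := Num.min e (pressure U / 2).
have d0 : 0 < d by rewrite lt_min e0 divr_gt0.
have dp : d <= pressure U / 2 by rewrite ge_min lexx orbT.
have dec p q : 0 <= p -> p < q -> state_eq U q < state_eq U p.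
  exact: (pressure_eq_decreasing adiabatic_coef_ge2 D0 E0 lt).
have f_lo : \forall V \near U, 0 < state_eq V (pressure U - d).
  apply: (cvgr_gt _ (state_eq_cvg _ _)); first lra.
  by rewrite -fp; apply: dec; lra.
have f_hi : \forall V \near U, state_eq V (pressure U + d) < 0.
  apply: (cvgr_lt _ (state_eq_cvg _ _)); first lra.
  by rewrite -fp; apply: dec; lra.
have nG := near_G GU.
near=> V.
have GV : G V by near: V.
have [pV0 fpV] := pressureP GV; have /GP[DV0 EV0 ltV] := GV.
have decV p q : 0 <= p -> p < q -> state_eq V q < state_eq V p.
  exact: (pressure_eq_decreasing adiabatic_coef_ge2 DV0 EV0 ltV).
have de : d <= e by rewrite ge_min lexx.
have lo : 0 < state_eq V (pressure U - d) by near: V.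
have hi : state_eq V (pressure U + d) < 0 by near: V.
apply: le_trans de; rewrite ler_norml; apply/andP; split.
  rewrite leNgt; apply/negP => lt1; move: hi; apply/negP; rewrite -leNgt -fpV ltW//.
  by apply: decV; lra.
rewrite leNgt; apply/negP => lt1; move: lo; apply/negP; rewrite -leNgt -fpV ltW//.
by apply: decV; lra.
Unshelve. all: by end_near. Qed.

End Admissible.

                       

(** * Real eigenvalues and the spectral radius *)

Section SpectralRadius.
Variable R : realType.

Lemma eigenvalue_trmx (F : fieldType) n (A : 'M[F]_n) a :
  eigenvalue A^T a = eigenvalue A a.
Proof.
rewrite !eigenvalue_root_char /char_poly /char_poly_mx -[in RHS]det_tr.
by rewrite linearB/= tr_scalar_mx map_trmx.
Qed.

(** The supremum bounds its set only if the set is bounded; the sum of the moduli of the roots of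
    the characteristic polynomial is an upper bound. *)
Lemma eigenvalue_le_spectral_radius (A : 'M[R]_4) a :
  eigenvalue A a -> `|a| <= spectral_radius A.
Proof.
move=> Aa; rewrite /spectral_radius.
set B := map_mx _ A; set S := [set _ | _ in _].
have -> : `|a| = Normc.normc (real_complex R a).
  by rewrite /Normc.normc/= expr0n/= addr0 sqrtr_sqr.
have [rs rsE] := closed_field_poly_normal (char_poly B).
apply: ub_le_sup; last first.
  by exists (real_complex R a) => //=; rewrite eigenvalue_map.
exists (\sum_(z <- rs) Normc.normc z) => _ [z /= + <-].
rewrite eigenvalue_root_char rsE rootZ; last first.
  by rewrite lead_coef_eq0 -size_poly_eq0 size_char_poly.
rewrite root_prod_XsubC => zrs.
rewrite (big_rem z)//= lerDl sumr_ge0// => y _; case: y => x y.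
exact: sqrtr_ge0.
Qed.

End SpectralRadius.

(** * Acoustic wave speeds *)

Section Waves.
Variable R : realType.
Implicit Types D m n E p A k l b : R.

(** At the root of [pressure_eq], with [v = m / A], [rho = D / W] and squared sound speed
    [c2 = gamma p / (rho h)], this is [(k - 1) rho h] times [(l - v)^2 (1 - c2) - (c2 / W^2) (1 -
    l^2)]. Its roots are the two acoustic speeds in the direction of the momentum [m]. *)
Definition wave_poly k D m n E p l : R :=
  let A := E + p in let s2 := inv_lorentz2 m n A in
  (l - m / A) ^+ 2 * ((k - 1) * (D * Num.sqrt s2) + k * (k - 2) * p)
  - k * p * s2 * (1 - l ^+ 2).

Lemma pressure_eq_swap k D m n E p :
  pressure_eq k D m n E p = pressure_eq k D n m E p.
Proof. by rewrite /pressure_eq /inv_lorentz2 [n / _ * _ + _]addrC. Qed.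

Section Root.
Variables k D m n E p : R.
Hypotheses (k_ge2 : 2 <= k) (D_gt0 : 0 < D) (p_gt0 : 0 < p) (A_gt0 : 0 < E + p).
Hypothesis l_gt0 : 0 < inv_lorentz2 m n (E + p).
Hypothesis root : pressure_eq k D m n E p = 0.
Local Notation A := (E + p).
Local Notation v := (m / A).
Local Notation w := (n / A).
Local Notation s := (Num.sqrt (inv_lorentz2 m n A)).

                                                                               
                                                                   
(** The direction is the acoustic eigenvector of the flux Jacobian, and [A * (l - v) ^+ 2] is its
    pressure variation. Once [D] is eliminated by the pressure equation and [w^2] by the Lorentz
    factor, the differential times [s^2] is exactly [- wave_poly]. *)
Lemma wave_pressure_diff l : wave_poly k D m n E p l = 0 ->
  pressure_eq_diff k D m n E p (D * (1 - v * l)) (A * l * (1 - v ^+ 2))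
    (A * w * (1 - v * l)) (A * (1 - v ^+ 2)) (A * (l - v) ^+ 2) = 0.
Proof.
have s0 : 0 < s by rewrite sqrtr_gt0.
have s2E : s ^+ 2 = inv_lorentz2 m n A by rewrite sqr_sqrtr// ltW.
have wE : w * w = 1 - v * v - s ^+ 2 by rewrite s2E /inv_lorentz2; ring.
move: root; rewrite /pressure_eq /wave_poly /pressure_eq_diff.
rewrite -s2E sqrtr_sqr (gtr0_norm s0); move: s0 wE; set sg := s.
move: (A_gt0); set a := A; move: v w => x y a0 s0 yE fp.
have DE : D = (a * sg ^+ 2 - k * p) / sg.
  by rewrite -[D](mulfK (lt0r_neq0 s0)); congr (_ / _); lra.
have dxE : x * ((a * l * (1 - x ^+ 2) - x * (a * (1 - x ^+ 2) + a * (l - x) ^+ 2)) / a) +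
    y * ((a * y * (1 - x * l) - y * (a * (1 - x ^+ 2) + a * (l - x) ^+ 2)) / a) =
    (l - x) * (l * sg ^+ 2 - (l - x)).
  transitivity (x * (l - x) * (1 - x * l) - y * y * l * (l - x)).
    by field; rewrite gt_eqF.
  by rewrite yE; ring.
rewrite dxE DE => Q0; apply: (mulfI (lt0r_neq0 (exprn_gt0 2 s0))).
rewrite mulr0 -[RHS]oppr0 -Q0; field.
by rewrite gt_eqF.
Qed.

(** The partial derivative in [p] is at most [2 - s^2 - k], since [v^2 + w^2 = 1 - s^2]. This makes
    implicit differentiation possible. *)
Lemma pressure_eq_diff_neg : pressure_eq_diff k D m n E p 0 0 0 0 1 < 0.
Proof.
have s0 : 0 < s by rewrite sqrtr_gt0.
have s2E : s ^+ 2 = inv_lorentz2 m n A by rewrite sqr_sqrtr// ltW.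
have vw : v ^+ 2 + w ^+ 2 = 1 - s ^+ 2 by rewrite s2E /inv_lorentz2; ring.
have -> : pressure_eq_diff k D m n E p 0 0 0 0 1 =
    s ^+ 2 + 2 * (v ^+ 2 + w ^+ 2) - D * (v ^+ 2 + w ^+ 2) / (A * s) - k.
  rewrite /pressure_eq_diff s2E; field.
  by rewrite !gt_eqF.
have : 0 <= D * (v ^+ 2 + w ^+ 2) / (A * s).
  by rewrite !mulr_ge0 ?addr_ge0 ?sqr_ge0 ?invr_ge0 ?mulr_ge0// ltW.
rewrite vw; have : 0 < s ^+ 2 by rewrite exprn_gt0.
move: (k_ge2); lra.
Qed.

Lemma pressure_eq_diff_inj dD dm dn dE dp dp' :
  pressure_eq_diff k D m n E p dD dm dn dE dp = 0 ->
  pressure_eq_diff k D m n E p dD dm dn dE dp' = 0 -> dp = dp'.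
Proof.
have s0 : 0 < s by rewrite sqrtr_gt0.
move=> e e'; apply/eqP; rewrite -subr_eq0; apply/eqP.
apply: (mulIf (ltr0_neq0 pressure_eq_diff_neg)); rewrite mul0r.
transitivity (pressure_eq_diff k D m n E p dD dm dn dE dp
              - pressure_eq_diff k D m n E p dD dm dn dE dp'); last first.
  by rewrite e e' subrr.
by rewrite /pressure_eq_diff; field; rewrite !gt_eqF.
Qed.

(** As a quadratic in [l], [wave_poly] has positive leading coefficient [c1 + c2] and the negative
    value [- c2 (1 - v^2)] at [v], so its roots lie strictly on either side of [v]. *)
Lemma wave_speeds : exists l1 l2,
  [/\ l1 < v, v < l2, wave_poly k D m n E p l1 = 0, wave_poly k D m n E p l2 = 0 &
      forall l, l <= l1 \/ l2 <= l -> 0 <= wave_poly k D m n E p l].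
Proof.
have s0 : 0 < s by rewrite sqrtr_gt0.
have v2 : v ^+ 2 < 1.
  have : 0 <= w ^+ 2 by rewrite sqr_ge0.
  by move: l_gt0; rewrite /inv_lorentz2 -!expr2; lra.
rewrite /wave_poly; move: l_gt0 s0 v2; set t := v.
move: (inv_lorentz2 m n A) => s2 s20 s0 t2.
have Ds : 0 < D * Num.sqrt s2 by rewrite mulr_gt0.
have c10 : 0 < (k - 1) * (D * Num.sqrt s2) + k * (k - 2) * p.
  rewrite ltr_wpDr ?mulr_ge0 ?mulr_gt0//; move: (k_ge2) (p_gt0); lra.
have c20 : 0 < k * p * s2 by rewrite !mulr_gt0//; move: (k_ge2); lra.
move: c10 c20; set c1 := _ + _; set c2 := k * p * s2 => c10 c20.
(* A quarter of the discriminant. *)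
pose d := c2 * (c1 * (1 - t ^+ 2) + c2).
have d0 : 0 < d by rewrite mulr_gt0// addr_gt0// mulr_gt0// subr_gt0.
have c0 : 0 < c1 + c2 by rewrite addr_gt0.
have q0 : 0 < Num.sqrt d by rewrite sqrtr_gt0.
have dE : Num.sqrt d ^+ 2 = d by rewrite sqr_sqrtr// ltW.
pose l1 := (c1 * t - Num.sqrt d) / (c1 + c2).
pose l2 := (c1 * t + Num.sqrt d) / (c1 + c2).
have QE l : (l - t) ^+ 2 * c1 - c2 * (1 - l ^+ 2) = (c1 + c2) * ((l - l1) * (l - l2)).
  apply: (mulfI (lt0r_neq0 c0)).
  transitivity (((c1 + c2) * l - c1 * t) ^+ 2 - d); first by rewrite /d; ring.
  by rewrite -dE /l1 /l2; field; rewrite gt_eqF.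
have : (c1 + c2) * ((t - l1) * (t - l2)) < 0.
  rewrite -QE subrr expr0n/= mul0r sub0r oppr_lt0 mulr_gt0// subr_gt0//.
rewrite pmulr_rlt0// => tl.
have l12 : l1 < l2.
  rewrite ltr_pM2r ?invr_gt0// ltrD2l; lra.
have lt1 : l1 < t.
  rewrite ltNge; apply/negP => tl1; move: tl; apply/negP; rewrite -leNgt.
  by rewrite mulr_le0// subr_le0//; lra.
have lt2 : t < l2.
  rewrite ltNge; apply/negP => tl1; move: tl; apply/negP; rewrite -leNgt.
  by rewrite mulr_ge0// subr_ge0//; lra.
exists l1, l2; split=> //; rewrite ?QE ?subrr ?(mul0r, mulr0)//.
move=> l ll; rewrite QE pmulr_rge0//; case: ll => ll.
  by rewrite mulr_le0// subr_le0; lra.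
by rewrite mulr_ge0// subr_ge0; lra.
Qed.

(** Multiplied by [k s^2], the gap between the two sides equals [p * wave_poly b] plus [(b - v)^2 p
    (k - 1) ((2 k - 1) D s + k (k - 2) p)]. The first term is nonnegative and the second is
    positive, as [k >= 2]. *)
Lemma shifted_state_subluminal b : b != v -> 0 <= wave_poly k D m n E p b ->
  (b * D - D * v) ^+ 2 + (b * m - (m * v + p)) ^+ 2 + (b * n - n * v) ^+ 2
  < (b * E - m) ^+ 2.
Proof.
move=> bv; have s0 : 0 < s by rewrite sqrtr_gt0.
have s2E : s ^+ 2 = inv_lorentz2 m n A by rewrite sqr_sqrtr// ltW.
have wE : w ^+ 2 = 1 - v ^+ 2 - s ^+ 2 by rewrite s2E /inv_lorentz2; ring.
move: root; rewrite /pressure_eq /wave_poly -s2E sqrtr_sqr (gtr0_norm s0).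
have -> : b * m - (m * v + p) = (b - v) * A * v - p by field; rewrite gt_eqF.
have -> : b * n - n * v = (b - v) * A * w by field; rewrite gt_eqF.
have -> : b * E - m = b * (A - p) - A * v by field; rewrite gt_eqF.
move: s0 wE bv.
move: s (A_gt0) v w => sg; set a := A => a0 x y sg0 yE bx fp Q0.
have N0 : 0 < (b - x) ^+ 2 by rewrite exprn_even_gt0// subr_eq0.
rewrite -subr_gt0.
have k0 : 0 < k by move: (k_ge2); lra.
have Z : 0 < k * sg ^+ 2 by rewrite mulr_gt0// exprn_gt0.
rewrite -(pmulr_rgt0 _ Z).
set rhs := (X in 0 < X).
have -> : rhs = p * ((b - x) ^+ 2 * ((k - 1) * (D * sg) + k * (k - 2) * p)
    - k * p * sg ^+ 2 * (1 - b ^+ 2))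
  + (b - x) ^+ 2 * (p * (k - 1) * ((2 * k - 1) * (D * sg) + k * (k - 2) * p)).
  have aE : a * sg ^+ 2 = D * sg + k * p by lra.
  rewrite /rhs.
  transitivity (k * ((b - x) ^+ 2 * ((a * sg ^+ 2) ^+ 2 / sg ^+ 2 * (1 - x ^+ 2 - y ^+ 2)
     - (D * sg) ^+ 2 - 2 * (a * sg ^+ 2) * p) - p ^+ 2 * sg ^+ 2 * (1 - b ^+ 2))).
    by field; rewrite gt_eqF.
  by rewrite yE aE; field; rewrite gt_eqF.
have Ds0 : 0 < D * sg by rewrite mulr_gt0.
have k1 : 0 < k - 1 by move: (k_ge2); lra.
have kp : 0 <= k * (k - 2) * p by rewrite !mulr_ge0 ?subr_ge0 ?(ltW k0) ?(ltW p_gt0).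
have kD : 0 < (2 * k - 1) * (D * sg) by rewrite mulr_gt0//; lra.
apply: ltr_wpDl; first by rewrite mulr_ge0// ltW.
apply: mulr_gt0 => //; apply: mulr_gt0; first exact: mulr_gt0.
exact: ltr_wpDr.
Qed.
End Root.
End Waves.

                                 

(** * Eigenvalues of the fluxes and the Lax--Friedrichs splitting, for both directions at once *)

Section DirectionalFlux.
Variable R : realType.
Implicit Types (U : state R) (y : bool).

                                                                         
(** The boolean is the direction of the flux, [false] for [flux1] and [true] for [flux2]; [cnorm]
    and [ctan] select the momenta along and across it. *)
Definition cnorm y : 'I_4 := if y then cm2 else cm1.
Definition ctan y : 'I_4 := if y then cm1 else cm2.

Definition dirstate y (D n t E : R) : state R :=
  if y then mkstate D t n E else mkstate D n t E.

Variant component_spec y : 'I_4 -> Type :=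
| ComponentD : component_spec y cD
| ComponentN : component_spec y (cnorm y)
| ComponentT : component_spec y (ctan y)
| ComponentE : component_spec y cE.

Lemma componentP y c : component_spec y c.
Proof.
case: c => -[|[|[|[|//]]]] i.
- by rewrite (_ : Ordinal i = cD); [constructor|exact: val_inj].
- rewrite (_ : Ordinal i = if y then ctan y else cnorm y); last first.
    by apply: val_inj; case: y.
  by case: y; constructor.
- rewrite (_ : Ordinal i = if y then cnorm y else ctan y); last first.
    by apply: val_inj; case: y.
  by case: y; constructor.
- by rewrite (_ : Ordinal i = cE); [constructor|exact: val_inj].
Qed.

Lemma dirstateE y D n t E :
  (dirstate y D n t E 0 cD = D) * (dirstate y D n t E 0 (cnorm y) = n) *
  (dirstate y D n t E 0 (ctan y) = t) * (dirstate y D n t E 0 cE = E).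
Proof. by case: y; rewrite !mxE. Qed.

Variable gamma : R.
Hypothesis gamma12 : 1 < gamma <= 2.
Local Notation k := (adiabatic_coef gamma).

Definition flux y : state R -> state R := if y then flux2 gamma else flux1 gamma.

Definition enthalpy U : R := U 0 cE + pressure gamma U.

Definition velocity y U : R := U 0 (cnorm y) / enthalpy U.

Lemma fluxE y U : G U -> flux y U =
  dirstate y (U 0 cD * velocity y U)
    (U 0 (cnorm y) * velocity y U + pressure gamma U)
    (U 0 (ctan y) * velocity y U) (U 0 (cnorm y)).
Proof.
move=> GU; have [p0 fp] := pressureP gamma12 GU.
rewrite /velocity /enthalpy.
by case: y; rewrite /flux /= /flux1 /flux2 (primitive_root gamma12 GU p0 fp).
Qed.

Definition wave y U (l : R) : R :=
  wave_poly k (U 0 cD) (U 0 (cnorm y)) (U 0 (ctan y)) (U 0 cE) (pressure gamma U) l.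

Section AdmissibleState.
Variables (y : bool) (U : state R).
Hypothesis GU : G U.
Local Notation p := (pressure gamma U).
Local Notation A := (enthalpy U).
Local Notation m := (U 0 (cnorm y)).
Local Notation n := (U 0 (ctan y)).

Let k_ge2 : 2 <= k. Proof. exact: adiabatic_coef_ge2. Qed.
Let D_gt0 : 0 < U 0 cD. Proof. by have /GP[] := GU. Qed.
Let E_gt0 : 0 < U 0 cE. Proof. by have /GP[] := GU. Qed.
Let p_gt0 : 0 < p. Proof. by have [] := pressureP gamma12 GU. Qed.
Let A_gt0 : 0 < A. Proof. by rewrite addr_gt0. Qed.

Let l_gt0 : 0 < inv_lorentz2 m n A.
Proof.
have /GP[D0 E0 lt] := GU; apply: (inv_lorentz2_gt0 D0 E0); last by rewrite lerDl ltW.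
by case: y; rewrite //= -addrA [X in _ + X]addrC addrA.
Qed.

Let root : pressure_eq k (U 0 cD) m n (U 0 cE) p = 0.
Proof.
have [_] := pressureP gamma12 GU; rewrite /state_eq.
by case: y; rewrite //= pressure_eq_swap.
Qed.

(** Implicit differentiation of the pressure makes the flux differentiable with an explicit
    differential. On the acoustic vector the pressure variation is the one found in
    [wave_pressure_diff], and the differential of the flux multiplies this vector by [l]. *)
Lemma flux_eigenvalue l : wave y U l = 0 -> eigenvalue (flux_jacobian (flux y) U) l.
Proof.
move=> Ql; pose phi (V : state R) c := V 0 c.
have phic c : phi V c @[V --> U] --> phi U c by exact: coord_continuous.
have pc := pressure_continuous gamma12 GU.
(* The pressure joins the conserved variables as an independent variable, at [None]. *)
pose psi V := ocons (pressure gamma V) (phi V).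
have psic o : psi V o @[V --> U] --> psi U o by case: o.
have nG := near_G GU.
have root0 : \forall V \near U, pressure_eq k (psi V (Some cD)) (psi V (Some (cnorm y)))
    (psi V (Some (ctan y))) (psi V (Some cE)) (psi V None) = 0.
  apply: filterS (nG) => V GV; have [_] := pressureP gamma12 GV.
  rewrite /state_eq /psi /phi /=.
  by case: y; rewrite //= pressure_eq_swap.
have sf := slope_pressure_eq k psic (slope_coord _ psi (Some cD))
  (slope_coord _ psi (Some (cnorm y))) (slope_coord _ psi (Some (ctan y)))
  (slope_coord _ psi (Some cE)) (slope_coord _ psi None) (lt0r_neq0 A_gt0) l_gt0.
have neg := pressure_eq_diff_neg k_ge2 D_gt0 A_gt0 l_gt0.
have [dp sp dpE] : exists2 dp, has_slope U phi (pressure gamma) dp & forall r,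
    pressure_eq_diff k (U 0 cD) m n (U 0 cE) p (r cD) (r (cnorm y)) (r (ctan y)) (r cE)
      (dp r) = 0.
  have [||dp ? ?] := implicit_slope pc sf; last by exists dp.
    have := nbhs_singleton root0; move: root0 => /[swap] ->.
    by [].
  exact: ltr0_neq0 neg.
have sv := slopeM phic (slope_coord _ phi (cnorm y))
  (slopeV phic (lt0r_neq0 A_gt0) (slopeD (slope_coord _ phi cE) sp)).
pose dv (r : 'I_4 -> R) := r (cnorm y) / A + m * (- (r cE + dp r) / A ^+ 2).
pose e (j : 'I_4) (r : 'I_4 -> R) := dirstate y
  (r cD * velocity y U + U 0 cD * dv r) (r (cnorm y) * velocity y U + m * dv r + dp r)
  (r (ctan y) * velocity y U + n * dv r) (r (cnorm y)) 0 j.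
have sF j : has_slope U (fun (V : state R) c => V 0 c) (fun V => flux y V 0 j) (e j).
  rewrite /e; case: (componentP y j).
  - apply: (slope_ext (slopeM phic (slope_coord _ phi cD) sv)).
      by apply: filterS (nG) => V GV; rewrite fluxE// !dirstateE.
    by move=> r; rewrite !dirstateE.
  - apply: (slope_ext (slopeD (slopeM phic (slope_coord _ phi (cnorm y)) sv) sp)).
      by apply: filterS (nG) => V GV; rewrite fluxE// !dirstateE.
    by move=> r; rewrite !dirstateE.
  - apply: (slope_ext (slopeM phic (slope_coord _ phi (ctan y)) sv)).
      by apply: filterS (nG) => V GV; rewrite fluxE// !dirstateE.
    by move=> r; rewrite !dirstateE.
  - apply: (slope_ext (slope_coord _ phi (cnorm y))).
      by apply: filterS (nG) => V GV; rewrite fluxE// !dirstateE.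
    by move=> r; rewrite !dirstateE.
have [dF dFE] := slope_differentiable sF.
pose v := m / A; pose w := n / A.
pose r := dirstate y (U 0 cD * (1 - v * l)) (A * l * (1 - v ^+ 2)) (A * w * (1 - v * l))
  (A * (1 - v ^+ 2)).
(* Eigenvectors are row vectors here, on which the untransposed [jacobian] acts as the differential.
   The energy entry [A (1 - v^2)] of [r] shows that it is nonzero. *)
rewrite /flux_jacobian eigenvalue_trmx; apply/eigenvalueP; exists r; last first.
  apply/eqP => /rowP/(_ cE); rewrite dirstateE mxE => /eqP; rewrite gt_eqF//.
  rewrite mulr_gt0// subr_gt0.
  have : 0 <= w * w by rewrite -expr2 sqr_ge0.
  by move: l_gt0; rewrite /inv_lorentz2 -/v -/w expr2; lra.
rewrite /jacobian mul_rV_lin1; apply/rowP => j; rewrite dFE /e.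
have dpV : dp (fun c => r 0 c) = A * (l - v) ^+ 2.
  apply: (pressure_eq_diff_inj k_ge2 D_gt0 A_gt0 l_gt0 (dpE _)).
  by rewrite !dirstateE; exact: wave_pressure_diff.
have dvE : dv (fun c => r 0 c) = (l - v) * (1 - v * l).
  rewrite /dv dpV !dirstateE /v; field.
  by rewrite gt_eqF.
rewrite !dirstateE dpV dvE mxE /r; case: (componentP y j); rewrite !dirstateE.
- by rewrite /velocity -/v; ring.
- by rewrite /velocity /v; field; rewrite gt_eqF.
- by rewrite /velocity /v /w; field; rewrite gt_eqF.
- by ring.
Qed.

Lemma norm_le_varrho l : wave y U l = 0 ->
  `|l| <= spectral_radius (flux_jacobian (flux y) U).
Proof. by move=> /flux_eigenvalue; exact: eigenvalue_le_spectral_radius. Qed.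

                                                                       
(** The hypothesis covers the whole half-line that starts at [b] and goes in the direction of [e]. A
    single point gives the quadratic inequality, but only the half-line gives the sign of the
    energy. *)
Lemma shifted_state_admissible (e b : R) : (e == 1) || (e == -1) ->
  (forall b', 0 <= e * (b' - b) -> 0 <= wave y U b' /\ 0 < e * (b' - velocity y U)) ->
  G (e *: (b *: U - flux y U)).
Proof.
move=> e1 H; have e2 : e ^+ 2 = 1 by case/orP: e1 => /eqP ->; rewrite ?sqrrN expr1n.
have sub b' : 0 <= e * (b' - b) ->
    (b' * U 0 cD - U 0 cD * velocity y U) ^+ 2
    + (b' * m - (m * velocity y U + p)) ^+ 2
    + (b' * n - n * velocity y U) ^+ 2 < (b' * U 0 cE - m) ^+ 2.
  move=> /H[Q0 N0].
  apply: (shifted_state_subluminal k_ge2 D_gt0 p_gt0 A_gt0 l_gt0 root) => //.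
  apply/eqP => bv; move: N0; rewrite -[velocity y U]/(m / A) -bv.
  by rewrite subrr mulr0 ltxx.
have bb : 0 <= e * (b - b) by rewrite subrr mulr0.
have [_ N0] := H b bb.
have E0 : 0 < e * (b * U 0 cE - m).
                                                                                    
  (* If the energy had the wrong sign, its zero [m / E] in the shift would lie on the half-line,
     where the quadratic inequality would put a sum of squares below zero. *)
  rewrite ltNge; apply/negP => E0.
  have b'b : 0 <= e * (m / U 0 cE - b).
    rewrite -(pmulr_rge0 _ E_gt0).
    have -> : U 0 cE * (e * (m / U 0 cE - b)) = - (e * (b * U 0 cE - m)).
      by field; rewrite gt_eqF.
    by rewrite oppr_ge0.
  have := sub _ b'b; rewrite divfK ?gt_eqF// subrr expr0n/=.
  by apply/negP; rewrite -leNgt !addr_ge0 ?sqr_ge0.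
apply/GP; rewrite fluxE//.
have coordE j : (e *: (b *: U - dirstate y (U 0 cD * velocity y U) (m * velocity y U + p)
    (n * velocity y U) m)) 0 j = e * (b * U 0 j - dirstate y (U 0 cD * velocity y U)
    (m * velocity y U + p) (n * velocity y U) m 0 j) by rewrite !mxE.
rewrite !coordE !dirstateE; split=> //.
  by rewrite [b * _]mulrC -mulrBr mulrCA mulr_gt0.
rewrite !exprMn e2 !mul1r; apply: le_lt_trans (sub b bb).
rewrite -!addrA lerD2l; case: (y); rewrite /= ?/cnorm ?/ctan /=
  !(dirstateE true, dirstateE false) //.
by rewrite addrC.
Qed.

(** Both acoustic speeds are eigenvalues, so they lie in [[-a, a]]. The half-line above [a] handles
    [a U - F], and the half-line below [-a] handles [a U + F = - (- a U - F)]. *)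
Lemma lax_friedrichs_splitting (a : R) :
  spectral_radius (flux_jacobian (flux y) U) <= a ->
  G (a *: U - flux y U) /\ G (a *: U + flux y U).
Proof.
move=> rho_le.
have [l1 [l2 [l1v vl2 Q1 Q2 Q]]] := wave_speeds k_ge2 D_gt0 p_gt0 l_gt0.
have := le_trans (norm_le_varrho Q1) rho_le; rewrite ler_norml => /andP[al1 _].
have := le_trans (norm_le_varrho Q2) rho_le; rewrite ler_norml => /andP[_ al2].
have vE : velocity y U = m / A by [].
split.
  rewrite -[_ - _]scale1r; apply: shifted_state_admissible; first by rewrite eqxx.
  move=> b; rewrite !mul1r vE => ab; split; last lra.
  by apply: Q; right; lra.
rewrite (_ : _ + _ = -1 *: (- a *: U - flux y U)); last first.
  by rewrite scaleN1r scaleNr opprB opprK addrC.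
apply: shifted_state_admissible; first by rewrite eqxx orbT.
move=> b; rewrite !mulN1r vE => ab; split; last lra.
by apply: Q; left; lra.
Qed.

End AdmissibleState.
End DirectionalFlux.

                    

(** * The convex cone [G] and the contraction used by the limiter *)

Section Cone.
Variable R : realType.
Implicit Types (U V : state R) (a t : R).

(** Minkowski's inequality; the Cauchy--Schwarz inequality behind it comes from Lagrange's
    identity. *)
Lemma sqrt3_triangle (x1 x2 x3 y1 y2 y3 : R) :
  Num.sqrt ((x1 + y1) ^+ 2 + (x2 + y2) ^+ 2 + (x3 + y3) ^+ 2) <=
  Num.sqrt (x1 ^+ 2 + x2 ^+ 2 + x3 ^+ 2) + Num.sqrt (y1 ^+ 2 + y2 ^+ 2 + y3 ^+ 2).
Proof.
have S3 (a b c : R) : 0 <= a ^+ 2 + b ^+ 2 + c ^+ 2 by rewrite !addr_ge0 ?sqr_ge0.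
rewrite -ler_sqr ?nnegrE ?addr_ge0 ?sqrtr_ge0//.
rewrite sqr_sqrtr// [leRHS]sqrrD !sqr_sqrtr// -sqrtrM//.
have : x1 * y1 + x2 * y2 + x3 * y3 <=
    Num.sqrt ((x1 ^+ 2 + x2 ^+ 2 + x3 ^+ 2) * (y1 ^+ 2 + y2 ^+ 2 + y3 ^+ 2)).
  apply: le_trans (ler_norm _) _; rewrite -sqrtr_sqr ler_wsqrtr// -subr_ge0.
  have -> : (x1 ^+ 2 + x2 ^+ 2 + x3 ^+ 2) * (y1 ^+ 2 + y2 ^+ 2 + y3 ^+ 2) -
      (x1 * y1 + x2 * y2 + x3 * y3) ^+ 2 =
      (x1 * y2 - x2 * y1) ^+ 2 + (x1 * y3 - x3 * y1) ^+ 2 + (x2 * y3 - x3 * y2) ^+ 2.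
    by ring.
  exact: S3.
lra.
Qed.

Lemma g_superadditive U V : g U + g V <= g (U + V).
Proof.
rewrite /g !mxE; set x := U 0 cD; set y := V 0 cD.
have := sqrt3_triangle x (U 0 cm1) (U 0 cm2) y (V 0 cm1) (V 0 cm2); lra.
Qed.

Lemma g_homogeneous a U : 0 <= a -> g (a *: U) = a * g U.
Proof.
move=> a0; rewrite /g !mxE !exprMn -!mulrDr sqrtrM ?sqr_ge0// sqrtr_sqr ger0_norm//.
by rewrite mulrBr.
Qed.

Lemma G_add U V : G U -> G V -> G (U + V).
Proof.
move=> [DU gU] [DV gV]; split; first by rewrite mxE addr_gt0.
exact: lt_le_trans (addr_gt0 gU gV) (g_superadditive _ _).
Qed.

Lemma G_scale a U : 0 < a -> G U -> G (a *: U).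
Proof.
move=> a0 [DU gU]; split; first by rewrite mxE mulr_gt0.
by rewrite g_homogeneous ?mulr_gt0// ltW.
Qed.

Lemma G_addZ a U V : 0 <= a -> G U -> G V -> G (U + a *: V).
Proof.
rewrite le_eqVlt => /orP[/eqP<-|a0] GU GV; first by rewrite scale0r addr0.
by apply: G_add => //; exact: G_scale.
Qed.

Lemma G_add_sum (I : Type) (r : seq I) (c : I -> R) (Z : I -> state R) U :
  (forall l, 0 <= c l) -> (forall l, G (Z l)) -> G U ->
  G (U + \sum_(l <- r) c l *: Z l).
Proof.
move=> c0 GZ; elim: r U => [|l r IHr] U GU; first by rewrite big_nil addr0.
by rewrite big_cons addrA; apply: IHr; exact: G_addZ.
Qed.

Lemma theta_ge0_le1 (qbar eps qmin : R) : 0 <= theta qbar eps qmin <= 1.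
Proof.
rewrite /theta; case: ifPn => _; first by rewrite ler01 lexx.
by rewrite le_min normr_ge0 ler01 ge_min lexx orbT.
Qed.

(** For [q < qbar] the choice of [theta] gives [theta * (qbar - qmin) <= qbar - eps], so the limited
    value stays at or above [eps]. For [q >= qbar] the limited value is at least [qbar]. *)
Lemma theta_gt0 (qbar eps qmin q : R) : 0 < eps <= qbar -> qmin <= q ->
  0 < theta qbar eps qmin * (q - qbar) + qbar.
Proof.
move=> /andP[eps0 epsq] qq; have /andP[t0 t1] := theta_ge0_le1 qbar eps qmin.
have [qqb|qqb] := leP qbar q.
  by rewrite ltr_wpDl ?mulr_ge0 ?subr_ge0//; exact: lt_le_trans epsq.
have qb : 0 < qbar - qmin by rewrite subr_gt0; exact: le_lt_trans qqb.
have t_le : theta qbar eps qmin * (qbar - qmin) <= qbar - eps.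
  rewrite /theta gt_eqF// -ler_pdivlMr// ge_min ger0_norm ?lexx//.
  by apply: divr_ge0; [rewrite subr_ge0|exact: ltW].
have : theta qbar eps qmin * (qbar - q) <= theta qbar eps qmin * (qbar - qmin).
  by rewrite ler_wpM2l// lerD2l lerN2.
lra.
Qed.

(** The limited state is a convex combination of [V] and [U]. By concavity its [g] is at least the
    scalar limited value of [g V], which is positive by [theta_gt0]. *)
Lemma G_limit eps gm U V : G U -> 0 < V 0 cD -> 0 < eps <= g U -> gm <= g V ->
  G (theta (g U) eps gm *: (V - U) + U).
Proof.
move=> [DU gU] DV epsU gmV; have /andP[] := theta_ge0_le1 (g U) eps gm.
have := theta_gt0 epsU gmV; set t := theta _ _ _ => tg t0 t1.
have -> : t *: (V - U) + U = t *: V + (1 - t) *: U.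
  by apply/rowP => c; rewrite !mxE; ring.
have t1' : 0 <= 1 - t by rewrite subr_ge0.
split.
  rewrite !mxE; have [->|tn1] := eqVneq t 1; first by rewrite mul1r subrr mul0r addr0.
  by rewrite ltr_wpDl ?mulr_ge0// ?ltW// mulr_gt0// subr_gt0 lt_neqAle tn1.
apply: lt_le_trans (g_superadditive _ _); rewrite !g_homogeneous//.
by move: tg; congr (_ < _); ring.
Qed.

End Cone.

(** * The limited point values and their complementary average *)

Section Limiter.
Variables (R : realType) (M : mesh R) (mu1 mu2 : R).
Variables (Ubar : int -> int -> state R) (Ustar : int -> int -> R -> R -> state R).
Hypothesis GUbar : forall i j, mesh_cell M i j -> G (Ubar i j).

Lemma mesh_index (n : nat) (i : int) : - 2%:Z <= i < n%:Z + 2%:Z ->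
  exists a : 'I_(n + 4), i = a%:Z - 2%:Z.
Proof.
case: i => i.
  move=> /andP[_ i_lt]; have an : (i + 2 < n + 4)%N by lia.
  by exists (Ordinal an) => /=; lia.
move=> /andP[i_ge _]; have an : (1 - i < n + 4)%N by lia.
by exists (Ordinal an) => /=; lia.
Qed.

Lemma index_mesh (n : nat) (a : 'I_(n + 4)) :
  - 2%:Z <= (a%:Z - 2%:Z) < n%:Z + 2%:Z.
Proof. have := ltn_ord a; lia. Qed.

Lemma min_over_cells_bounds (q : state R -> R) i j :
  (forall U, G U -> 0 < q U) -> mesh_cell M i j ->
  0 < min_over_cells M Ubar q <= q (Ubar i j).
Proof.
move=> q0 [/mesh_index[a ->] /mesh_index[b ->]]; rewrite /min_over_cells.
have t0 : 0 < (10 ^- 13 : R) by rewrite invr_gt0 exprn_gt0.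
apply/andP; split; last first.
  by apply: (@bigmin_inf _ _ _ _ a) => //; exact: (@bigmin_inf _ _ _ _ b).
apply: lt_bigmin => // c _; apply: lt_bigmin => // d _.
by apply/q0/GUbar; split; exact: index_mesh.
Qed.

Local Notation Ulim := (pcp_limit M mu1 mu2 Ubar Ustar).

Lemma PiAvg_coord (Zbar : state R) Z c :
  PiAvg mu1 mu2 Zbar Z 0 c = PiAvg mu1 mu2 (Zbar 0 c : R^o) (fun a b => Z a b 0 c : R^o).
Proof.
rewrite /PiAvg !mxE summxE; congr (_ * (_ - _)); apply: eq_bigr => l _.
by rewrite !mxE.
Qed.

(** The Gauss weights sum to one, so when [mu1 + mu2 = 1] the weights of [PiAvg] also sum to one. It
    is then an affine combination, which commutes with scaling about [zbar]. *)
Lemma PiAvg_limit_scalar t (zbar : R^o) (z : R -> R -> R^o) : mu1 + mu2 = 1 ->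
  PiAvg mu1 mu2 zbar (fun a b => t * (z a b - zbar) + zbar : R^o) =
  t * (PiAvg mu1 mu2 zbar z - zbar) + zbar :> R.
Proof.
move=> /eqP; rewrite eq_sym -subr_eq => /eqP <-.
rewrite /PiAvg !big_ord_recl !big_ord0 /gw /what1 /= /GRing.scale /=.
by field.
Qed.

Lemma PiAvg_limit t (Zbar : state R) Z : mu1 + mu2 = 1 ->
  PiAvg mu1 mu2 Zbar (fun a b => t *: (Z a b - Zbar) + Zbar) =
  t *: (PiAvg mu1 mu2 Zbar Z - Zbar) + Zbar.
Proof.
move=> mu12; apply/rowP => c.
have cE (P Q : state R) : (t *: (P - Q) + Q) 0 c = t * (P 0 c - Q 0 c) + Q 0 c.
  by rewrite !mxE.
rewrite cE !PiAvg_coord -PiAvg_limit_scalar//.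
by congr PiAvg; apply/funext => a; apply/funext => b; rewrite cE.
Qed.

Section Cell.
Variables i j : int.
Hypothesis ij : mesh_cell M i j.

Let GU : G (Ubar i j). Proof. exact: GUbar. Qed.

Let epsD_bounds : 0 < epsD M Ubar <= Dbar Ubar i j.
Proof. by apply: min_over_cells_bounds ij => U []. Qed.

Let epsg_bounds : 0 < epsg M Ubar <= g (Ubar i j).
Proof. by apply: min_over_cells_bounds ij => U []. Qed.

Lemma pcp_limit_admissible z : z \in Theta R -> G (Ulim i j z.1 z.2).
Proof.
move=> zT; apply: G_limit => //.
  rewrite /Utilde mxE/=; apply: theta_gt0 => //.
  exact: (@ge_bigmin_seq _ _ _ _ _ z xpredT _ zT isT).
exact: (@ge_bigmin_seq _ _ _ _ _ z xpredT _ zT isT).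
Qed.

Lemma PiAvg_pcp_limit_admissible :
  mu1 + mu2 = 1 -> G (PiAvg mu1 mu2 (Ubar i j) (Ulim i j)).
Proof.
(* [PiAvg] of the limited states is the limited [PiAvg], and its value is the default of the minimum
   defining [gmin], hence [bigmin_le_id]. The same happens for [Dmin] below. *)
move=> mu12; rewrite PiAvg_limit//; apply: G_limit => //; last exact: bigmin_le_id.
rewrite PiAvg_coord.
have -> : (fun a b => Utilde M mu1 mu2 Ubar Ustar i j a b 0 cD : R^o) =
    (fun a b => theta (Dbar Ubar i j) (epsD M Ubar) (Dmin mu1 mu2 Ubar Ustar i j)
       * (Ustar i j a b 0 cD - Dbar Ubar i j) + Dbar Ubar i j).
  by apply/funext => a; apply/funext => b; rewrite mxE.
rewrite PiAvg_limit_scalar//; apply: theta_gt0 => //.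
exact: bigmin_le_id.
Qed.

End Cell.
End Limiter.

                             

(** * The updated average as a combination of admissible states *)

Section Decomposition.
Variables (R : realType) (gamma : R) (M : mesh R) (alpha1 alpha2 : R).
Variable (U : int -> int -> R -> R -> state R).

(** The four splitting states of one direction: outer and inner traces at the right face, with
    [- F], then inner and outer traces at the left face, with [+ F]. *)
Definition face_sum (F : state R -> state R) (a : R) (Ro Ri Li Lo : state R) : state R :=
  (a *: Ro - F Ro) + (a *: Ri - F Ri) + (a *: Li + F Li) + (a *: Lo + F Lo).

Lemma lax_friedrichs_diff (F : state R -> state R) (a : R) (Ro Ri Li Lo : state R) :
  lax_friedrichs F a Ri Ro - lax_friedrichs F a Lo Li =
  - (2^-1 *: face_sum F a Ro Ri Li Lo - a *: (Ri + Li)).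
Proof. by apply/rowP => c; rewrite !mxE; field. Qed.

(** The definition of [PiAvg] splits the old average into [PiAvg] and the inner traces. By
    [lax_friedrichs_diff] a flux difference is a half [face_sum] minus [alpha] times the inner
    traces, and the traces from both sources are collected. *)
Lemma convex_decomposition (mu1 mu2 dt : R) (Ubar : int -> int -> state R) i j :
  Ubar i j + dt *: LU gamma M alpha1 alpha2 U i j =
  (1 - 2 * what1 R) *: PiAvg mu1 mu2 (Ubar i j) (U i j) +
  \sum_(l < 3) gw R l *:
    ((dt / dx M / 2) *: face_sum (flux1 gamma) alpha1
       (U (i + 1) j (- (1 / 2)) (gb R l)) (U i j (1 / 2) (gb R l))
       (U i j (- (1 / 2)) (gb R l)) (U (i - 1) j (1 / 2) (gb R l))
     + (dt / dy M / 2) *: face_sum (flux2 gamma) alpha2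
       (U i (j + 1) (gb R l) (- (1 / 2))) (U i j (gb R l) (1 / 2))
       (U i j (gb R l) (- (1 / 2))) (U i (j - 1) (gb R l) (1 / 2))
     + (what1 R * mu1 - dt / dx M * alpha1) *:
         (U i j (1 / 2) (gb R l) + U i j (- (1 / 2)) (gb R l))
     + (what1 R * mu2 - dt / dy M * alpha2) *:
         (U i j (gb R l) (1 / 2) + U i j (gb R l) (- (1 / 2)))).
Proof.
have w0 : 1 - 2 * what1 R != 0 by rewrite /what1 gt_eqF//; lra.
rewrite /PiAvg scalerA divff// scale1r -[RHS]addrA; congr (_ + _).
rewrite /LU -opprD scalerN -[RHS]opprK; congr (- _).
rewrite -big_split/= opprD opprK -sumrN -big_split/= scaler_sumr.
apply: eq_bigr => l _.
rewrite /num_flux1 /num_flux2 [i - 1 + 1]subrK [j - 1 + 1]subrK.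
rewrite lax_friedrichs_diff lax_friedrichs_diff.
set X := face_sum _ _ _ _ _ _; set Y := face_sum _ _ _ _ _ _.
by apply/rowP => c; rewrite !mxE; ring.
Qed.

Lemma bigmax3_ge n1 n2 n3 (F : 'I_n1 -> 'I_n2 -> 'I_n3 -> R) a b c :
  F a b c <= \big[Num.max/0]_a \big[Num.max/0]_b \big[Num.max/0]_c F a b c.
Proof.
apply: le_trans (le_bigmax _ (fun a => \big[Num.max/0]_b \big[Num.max/0]_c F a b c) a).
apply: le_trans (le_bigmax _ (fun b => \big[Num.max/0]_c F a b c) b).
exact: le_bigmax.
Qed.

Lemma max_varrho1_ge (i : nat) (j : int) l : (i <= nx M)%N -> 0 <= j < (ny M)%:Z ->
  varrho1 gamma (U (i%:Z - 1) j (1 / 2) (gb R l)) <= max_varrho1 gamma M U /\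
  varrho1 gamma (U i%:Z j (- (1 / 2)) (gb R l)) <= max_varrho1 gamma M U.
Proof.
case: j => [j|j]; last by rewrite ltNge.
rewrite -ltnS => i_lt j_lt.
have := bigmax3_ge (fun (a : 'I_(nx M).+1) (b : 'I_(ny M)) l =>
  Num.max (varrho1 gamma (U (a%:Z - 1) b%:Z (1 / 2) (gb R l)))
          (varrho1 gamma (U a%:Z b%:Z (- (1 / 2)) (gb R l))))
  (Ordinal i_lt) (Ordinal (j_lt : (j < ny M)%N)) l.
rewrite ge_max => /andP[le_l le_r]; split; [exact: le_l|exact: le_r].
Qed.

Lemma max_varrho2_ge (i : int) (j : nat) l : (j <= ny M)%N -> 0 <= i < (nx M)%:Z ->
  varrho2 gamma (U i (j%:Z - 1) (gb R l) (1 / 2)) <= max_varrho2 gamma M U /\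
  varrho2 gamma (U i j%:Z (gb R l) (- (1 / 2))) <= max_varrho2 gamma M U.
Proof.
case: i => [i|i]; last by rewrite ltNge.
rewrite -ltnS => j_lt i_lt.
have := bigmax3_ge (fun (a : 'I_(nx M)) (b : 'I_(ny M).+1) l =>
  Num.max (varrho2 gamma (U a%:Z (b%:Z - 1) (gb R l) (1 / 2)))
          (varrho2 gamma (U a%:Z b%:Z (gb R l) (- (1 / 2)))))
  (Ordinal (i_lt : (i < nx M)%N)) (Ordinal j_lt) l.
rewrite ge_max => /andP[le_l le_r]; split; [exact: le_l|exact: le_r].
Qed.

End Decomposition.

(** * Faces of an inner cell, and assembly of the proof *)

Lemma Theta_faces (R : realType) l :
  [/\ (1 / 2, gb R l) \in Theta R, (- (1 / 2), gb R l) \in Theta R,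
      (gb R l, 1 / 2) \in Theta R & (gb R l, - (1 / 2)) \in Theta R].
Proof.
have lI : l \in enum 'I_3 by rewrite mem_enum.
rewrite /Theta; split; rewrite mem_cat; apply/orP; right; rewrite mem_cat; apply/orP.
- by left; apply: (allpairs_f (fun s k => (s, gb R k)) _ lI); rewrite !inE eqxx.
- by left; apply: (allpairs_f (fun s k => (s, gb R k)) _ lI); rewrite !inE eqxx orbT.
- by right; apply: (allpairs_f (fun k s => (gb R k, s)) lI); rewrite !inE eqxx.
- by right; apply: (allpairs_f (fun k s => (gb R k, s)) lI); rewrite !inE eqxx orbT.
Qed.

Lemma inner_cell_neighbours (R : realType) (M : mesh R) i j : inner_cell M i j ->
  [/\ mesh_cell M i j, mesh_cell M (i + 1) j, mesh_cell M (i - 1) j,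
      mesh_cell M i (j + 1) & mesh_cell M i (j - 1)].
Proof.
have shift (n : nat) (a e : int) : 0 <= a < n%:Z -> -1 <= e <= 1 ->
  - 2%:Z <= a + e < n%:Z + 2%:Z by lia.
have stay (n : nat) (a : int) : 0 <= a < n%:Z -> - 2%:Z <= a < n%:Z + 2%:Z by lia.
by move=> [iI jI]; split; split; rewrite ?shift ?stay.
Qed.

Lemma max_varrho1_faces (R : realType) gamma (M : mesh R)
    (U : int -> int -> R -> R -> state R) i j l : inner_cell M i j ->
  [/\ varrho1 gamma (U (i - 1) j (1 / 2) (gb R l)) <= max_varrho1 gamma M U,
      varrho1 gamma (U i j (- (1 / 2)) (gb R l)) <= max_varrho1 gamma M U,
      varrho1 gamma (U i j (1 / 2) (gb R l)) <= max_varrho1 gamma M U &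
      varrho1 gamma (U (i + 1) j (- (1 / 2)) (gb R l)) <= max_varrho1 gamma M U].
Proof.
move=> [iI jI]; case: i iI => [i|i]; last by rewrite ltNge.
move=> i_lt; have {}i_lt : (i < nx M)%N by [].
have [le1 le2] := max_varrho1_ge gamma U l (ltnW i_lt) jI.
(* The right face of cell [i] is the left face of cell [i + 1], an index still within the range of
   the maximum. *)
have := max_varrho1_ge gamma U l i_lt jI; rewrite -addn1 PoszD addrK => -[le3 le4].
by split; [exact: le1|exact: le2|exact: le3|exact: le4].
Qed.

Lemma max_varrho2_faces (R : realType) gamma (M : mesh R)
    (U : int -> int -> R -> R -> state R) i j l : inner_cell M i j ->
  [/\ varrho2 gamma (U i (j - 1) (gb R l) (1 / 2)) <= max_varrho2 gamma M U,
      varrho2 gamma (U i j (gb R l) (- (1 / 2))) <= max_varrho2 gamma M U,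
      varrho2 gamma (U i j (gb R l) (1 / 2)) <= max_varrho2 gamma M U &
      varrho2 gamma (U i (j + 1) (gb R l) (- (1 / 2))) <= max_varrho2 gamma M U].
Proof.
move=> [iI jI]; case: j jI => [j|j]; last by rewrite ltNge.
move=> j_lt; have {}j_lt : (j < ny M)%N by [].
have [le1 le2] := max_varrho2_ge gamma U l (ltnW j_lt) iI.
have := max_varrho2_ge gamma U l j_lt iI; rewrite -addn1 PoszD addrK => -[le3 le4].
by split; [exact: le1|exact: le2|exact: le3|exact: le4].
Qed.

Lemma face_sum_admissible (R : realType) (gamma : R) y a Ro Ri Li Lo :
  let rho V := spectral_radius (flux_jacobian (flux gamma y) V) in
  1 < gamma <= 2 -> G Ro -> G Ri -> G Li -> G Lo ->
  [/\ rho Lo <= a, rho Li <= a, rho Ri <= a & rho Ro <= a] ->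
  G (face_sum (flux gamma y) a Ro Ri Li Lo).
Proof.
move=> rho gamma12 GRo GRi GLi GLo [rLo rLi rRi rRo].
have [mRo _] := lax_friedrichs_splitting gamma12 GRo rRo.
have [mRi _] := lax_friedrichs_splitting gamma12 GRi rRi.
have [_ pLi] := lax_friedrichs_splitting gamma12 GLi rLi.
have [_ pLo] := lax_friedrichs_splitting gamma12 GLo rLo.
exact: G_add (G_add (G_add mRo mRi) pLi) pLo.
Qed.

(** The two bounds on [dt] make the coefficients of the inner traces in [convex_decomposition]
    nonnegative; every state appearing there is in [G]. *)
Lemma scheme_admissible (R : realType) (gamma : R) (M : mesh R) (mu1 mu2 dt : R)
    (Ubar : int -> int -> state R) (U : int -> int -> R -> R -> state R) i j :
  let alpha1 := max_varrho1 gamma M U in let alpha2 := max_varrho2 gamma M U in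
  1 < gamma <= 2 -> 0 < dt -> inner_cell M i j ->
  (forall i j, mesh_cell M i j -> forall z, z \in Theta R -> G (U i j z.1 z.2)) ->
  G (PiAvg mu1 mu2 (Ubar i j) (U i j)) ->
  dt / dx M * alpha1 <= what1 R * mu1 -> dt / dy M * alpha2 <= what1 R * mu2 ->
  G (Ubar i j + dt *: LU gamma M alpha1 alpha2 U i j).
Proof.
move=> alpha1 alpha2 gamma12 dt0 ij GU GPi c1 c2.
have [ij0 ijE ijW ijN ijS] := inner_cell_neighbours ij.
rewrite (convex_decomposition gamma M alpha1 alpha2 U mu1 mu2).
have w0 : 0 < 1 - 2 * what1 R by rewrite /what1; lra.
apply: (G_add_sum _ _ _ (G_scale w0 GPi)) => l.
  by rewrite /gw; case: l => -[|[|[|//]]] /= _; lra.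
have [tR tL tT tB] := Theta_faces R l.
have GR := GU _ _ ij0 _ tR; have GL := GU _ _ ij0 _ tL.
have GT := GU _ _ ij0 _ tT; have GB := GU _ _ ij0 _ tB.
have G1 := face_sum_admissible (y := false) gamma12 (GU _ _ ijE _ tL) GR GL
  (GU _ _ ijW _ tR) (max_varrho1_faces gamma U l ij).
have G2 := face_sum_admissible (y := true) gamma12 (GU _ _ ijN _ tB) GT GB
  (GU _ _ ijS _ tT) (max_varrho2_faces gamma U l ij).
have dx2 : 0 < dt / dx M / 2 by rewrite !divr_gt0// dx_gt0.
have dy2 : 0 < dt / dy M / 2 by rewrite !divr_gt0// dy_gt0.
rewrite -subr_ge0 in c1; rewrite -subr_ge0 in c2.
apply: (G_addZ c2 _ (G_add GT GB)); apply: (G_addZ c1 _ (G_add GR GL)).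
exact: G_add (G_scale dx2 G1) (G_scale dy2 G2).
Qed.

Theorem theorem4p1 (R : realType) (gamma : R) (M : mesh R) (H : hweno_param R)
                                                                               
                          
  (Ubar Vbar Wbar V W : int -> int -> state R)
  (troubled : int -> int -> bool)
  (R1 R2 : int -> int -> 'M[R]_4)
  (dt alpha1 alpha2 : R) :
  let lambda1 := dt / dx M in
  let lambda2 := dt / dy M in
  let mu1 := lambda1 * alpha1 / (lambda1 * alpha1 + lambda2 * alpha2) in
  let mu2 := lambda2 * alpha2 / (lambda1 * alpha1 + lambda2 * alpha2) in
  let U := pcp_limit M mu1 mu2 Ubar
             (reconstruct M H troubled Ubar V W R1 R2) in
  1 < gamma <= 2 ->
  0 < dt ->
  (forall i j, ~~ troubled i j -> V i j = Vbar i j /\ W i j = Wbar i j) ->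
  (forall i j, mesh_cell M i j -> mesh_cell M (i + 1) j ->
     exists2 A, roe_matrix (flux1 gamma) (Ubar i j) (Ubar (i + 1) j) A
              & right_eigenvector_matrix A (R1 i j)) ->
  (forall i j, mesh_cell M i j -> mesh_cell M i (j + 1) ->
     exists2 A, roe_matrix (flux2 gamma) (Ubar i j) (Ubar i (j + 1)) A
              & right_eigenvector_matrix A (R2 i j)) ->
  alpha1 = max_varrho1 gamma M U ->
  alpha2 = max_varrho2 gamma M U ->
  (forall i j, mesh_cell M i j -> G (Ubar i j)) ->
  dt <= what1 R / (alpha1 / dx M + alpha2 / dy M) ->
  forall i j, inner_cell M i j ->
    G (Ubar i j + dt *: LU gamma M alpha1 alpha2 U i j).
Proof.
move=> lambda1 lambda2 mu1 mu2 U gamma12 dt0 _ _ _ a1E a2E GUbar cfl i j ij.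
have dx0 := dx_gt0 M; have dy0 := dy_gt0 M.
have a1_ge0 : 0 <= alpha1 by rewrite a1E bigmax_ge_id.
have a2_ge0 : 0 <= alpha2 by rewrite a2E bigmax_ge_id.
have l1_gt0 : 0 < lambda1 by rewrite divr_gt0.
have l2_gt0 : 0 < lambda2 by rewrite divr_gt0.
pose S := lambda1 * alpha1 + lambda2 * alpha2.
have SE : S = dt * (alpha1 / dx M + alpha2 / dy M).
  by rewrite /S /lambda1 /lambda2; ring.
have s_ge0 : 0 <= alpha1 / dx M + alpha2 / dy M.
  by rewrite addr_ge0// divr_ge0// ltW.
have s_gt0 : 0 < alpha1 / dx M + alpha2 / dy M.
  (* If both speeds vanished, the quotient in the CFL condition would be zero, by the convention for
     division by zero, which contradicts [0 < dt]. Hence [mu1] and [mu2] are genuine quotients. *)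
  rewrite lt_def s_ge0 andbT; apply/eqP => s0.
  by move: cfl; rewrite s0 invr0 mulr0 leNgt dt0.
have S_gt0 : 0 < S by rewrite SE mulr_gt0.
have S_le : S <= what1 R by rewrite SE -ler_pdivlMr.
have mu12 : mu1 + mu2 = 1 by rewrite -mulrDl divff// gt_eqF.
have mu1_ge0 : 0 <= mu1 by rewrite divr_ge0 ?(ltW S_gt0)// mulr_ge0// ltW.
have mu2_ge0 : 0 <= mu2 by rewrite divr_ge0 ?(ltW S_gt0)// mulr_ge0// ltW.
have Gpt i' j' : mesh_cell M i' j' -> forall z, z \in Theta R -> G (U i' j' z.1 z.2).
  by move=> ij' z zT; exact: pcp_limit_admissible.
have [ij0 _ _ _ _] := inner_cell_neighbours ij.
have GPi : G (PiAvg mu1 mu2 (Ubar i j) (U i j)) by exact: PiAvg_pcp_limit_admissible.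
rewrite a1E a2E; apply: (scheme_admissible gamma12 dt0 ij Gpt GPi).
  (* With [S <= what1], this is where the CFL condition enters in each direction. *)
  rewrite -a1E; have -> : dt / dx M * alpha1 = S * mu1.
    by rewrite /mu1 -/S [S * _]mulrC divfK// gt_eqF.
  by rewrite ler_wpM2r.
rewrite -a2E; have -> : dt / dy M * alpha2 = S * mu2.
  by rewrite /mu2 -/S [S * _]mulrC divfK// gt_eqF.
by rewrite ler_wpM2r.
Qed.
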